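(* Let $K>0$ be a constant. Suppose that $x\ge3$, that $\mathcal{P}$ is a subset of the primes $\le x$, that $\mathcal{E}=\{p\le x:\ p\text{ prime},\ p\notin\mathcal{P}\}$, and that $u\in[1,\log x]$ is such that $$\kappa:=\sum_{\substack{p\in\mathcal{P} \\ x^{1/u}<p\le x}}\frac1p\ \le\ K.$$ Then, with implied constants depending only on $K$: (a) There exists $t\in[x^{1/2},x]$ such that $$\frac{\Psi(t;\mathcal{P})}{t}\ \ll\ \left(\kappa+x^{-1/6}+u^{-u/4}\right)\prod_{\substack{p\in\mathcal{E} \\ p\le t}}\left(1-\frac1p\right).$$ (b) If, in addition, $\mathcal{P}\subset[1,x^{1-\epsilon}]$ for some $\epsilon>0$, then we can take $t=x$ provided we replace $\kappa$ by $\kappa/\epsilon$, that is, $$\frac{\Psi(x;\mathcal{P})}{x}\ \ll\ \left(\frac{\kappa}{\epsilon}+x^{-1/6}+u^{-u/4}\right)\prod_{p\in\mathcal{E}}\left(1-\frac1p\right).$$ In either case (with $\epsilon$ fixed in case (b)), if $\kappa=o(1)$ as $u\to\infty$ and $x\to\infty$, then $\Psi(t;\mathcal{P})/t=o\Big(\prod_{p\in\mathcal{E},\,p\le t}(1-1/p)\Big)$ for this $t$.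
   Context: $\Psi(t;\mathcal{P})$ denotes the number of positive integers $n\le t$ all of whose prime factors lie in $\mathcal{P}$. $f\ll g$ means $f\le Cg$ for a constant $C$. *)

(* Defs.v *)
From HB Require Import structures.
From mathcomp Require Import all_boot all_order all_algebra.
From mathcomp Require Import all_classical all_reals all_analysis.

Set Implicit Arguments.
Unset Strict Implicit.
Unset Printing Implicit Defensive.

Import Order.TTheory GRing.Theory Num.Theory.
Import numFieldNormedType.Exports.

Local Open Scope classical_set_scope.
Local Open Scope ring_scope.

Section Defs.
Context {R : realType}.
Implicit Types (x t u K C : R) (P Q : nat_pred).

(* [P.-nat n] says that n > 0 and that all prime factors of n lie in P. *)
Definition Psi t P : nat :=
  (\sum_(1 <= n < (Num.truncn t).+1 | P.-nat n) 1)%N.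

Definition excluded x P : nat_pred :=
  [pred p : nat | [&& prime p, p%:R <= x & p \notin P]].

Definition kappa x P u : R :=
  \sum_(1 <= p < (Num.truncn x).+1 | (p \in P) && (x `^ u^-1 < p%:R)) p%:R^-1.

Definition euler_prod Q t : R :=
  \prod_(1 <= p < (Num.truncn t).+1 | p \in Q) (1 - p%:R^-1).

Definition admissible K x P u : Prop :=
  [/\ 3 <= x,
      forall p : nat, p \in P -> prime p /\ p%:R <= x,
      1 <= u <= ln x
    & kappa x P u <= K].

(* The inequality of part (a) at the point t, with implied constant C. *)
Definition sieve_bound_at C x P u t : Prop :=
  (Psi t P)%:R / t <=
    C * (kappa x P u + x `^ (- (1 / 6)) + u `^ (- (u / 4)))
      * euler_prod (excluded x P) t.

End Defs.

(* Main.v *)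
(* Psi(t; P) log t is estimated by writing log n as a sum over the prime powers
   dividing n, which gives Hall's bound Psi(t; P) << (t / log t) sum 1/n, and, when
   all primes of P are at most z, a variant twisted by n^d that combines it with
   Rankin's trick.  Mertens' lower bound for prod (1 - 1/p) turns the Euler product
   over P into the one over the excluded primes.  With z = x^(1/u), the z-smooth n
   contribute x^(-1/6) + u^(-u/4) by the twisted bound.  The others are divisible
   by some prime p > z of P, hence number at most the sum over p of Psi(t/p; P):
   in (b) Hall's bound at x/p >= x^eps makes this << kappa / eps, and in (a) one
   averages over the integers t in [sqrt x, x] instead. *)

Require Import Defs.
From HB Require Import structures.
From mathcomp Require Import all_boot all_order all_algebra.
From mathcomp Require Import all_classical all_reals all_analysis.
From mathcomp Require Import zify ring lra.

Set Implicit Arguments.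
Unset Strict Implicit.
Unset Printing Implicit Defensive.

Import Order.TTheory GRing.Theory Num.Theory.
Import numFieldNormedType.Exports.

Local Open Scope classical_set_scope.
Local Open Scope ring_scope.

(** * Chebyshev and Mertens sums *)

(** Every estimate for Psi is carried in the weighted form [(1 + ln t) * Psi * euler_prod P t <= B].
    Mertens' theorem is then needed only as a lower bound, and only in the last conversion, where it
    trades the whole weight for the product over the excluded primes. The saving u^(-u/4) is
    available only for large u, since Rankin's trick costs a factor that a large u has to absorb;
    the threshold chosen is 648^8. In (a) the averaging controls the large primes with the Euler
    product over P up to x, while the weight at t carries the larger product up to t. The ratio of
    the two is at most exp(2 kappa), which is why exp(2K) appears in the constant. *)

Lemma sum_multiples (V : nmodType) (P : pred nat) (F : nat -> V) (d N : nat) :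
  (0 < d)%N ->
  \sum_(1 <= n < N.+1 | (d %| n)%N && P n) F n =
  \sum_(1 <= m < (N %/ d).+1 | P (d * m)%N) F (d * m)%N.
Proof.
move=> d0; rewrite big_mkcond [RHS]big_mkcond /=.
elim: N => [|N IH]; first by rewrite div0n !big_geq.
rewrite big_nat_recr //= IH divnS //.
have [dN|dN] /= := boolP (d %| N.+1)%N; last by rewrite addr0.
rewrite add1n [RHS]big_nat_recr //=.
have <- : N.+1 = (d * (N %/ d).+1)%N by rewrite -{1}(divnK dN) divnS // dN mulnC.
by [].
Qed.

Lemma ln_prod (R : realType) (I : Type) (r : seq I) (P : pred I) (F : I -> R) :
  (forall i, P i -> 0 < F i) ->
  ln (\prod_(i <- r | P i) F i) = \sum_(i <- r | P i) ln (F i).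
Proof.
move=> F0.
suff [] : 0 < \prod_(i <- r | P i) F i /\
  ln (\prod_(i <- r | P i) F i) = \sum_(i <- r | P i) ln (F i) by [].
elim/big_ind2 : _ => [|x1 x2 y1 y2 [? <-] [? <-]|i Pi]; first by rewrite ln1.
- by split; [exact: mulr_gt0|rewrite lnM].
- by split=> //; exact: F0.
Qed.

Lemma ln_logn (R : realType) (n N : nat) : (0 < n <= N)%N ->
  ln (n%:R : R) =
  \sum_(1 <= p < N.+1 | prime p) (logn p n)%:R * ln (p%:R : R).
Proof.
move=> /andP[n0 nN].
rewrite -{1}(partnT n0) (widen_partn _ nN) big_ltn_cond //.
rewrite (_ : (0 ^ logn 0 n)%N = 1%N) // inE mul1n natr_prod ln_prod; last first.
  move=> p _; rewrite ltr0n expn_gt0; case: p => [|//].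
  by rewrite lognE.
rewrite [RHS]big_mkcond /=; apply: eq_bigr => p _.
case: ifPn => [pp|npp]; last by rewrite lognE (negbTE npp) expn0 ln1.
by rewrite natrX lnXn ?ltr0n ?prime_gt0 // mulr_natl.
Qed.

Lemma sum_ln_primes_le (R : realType) (N n : nat) : (0 < n)%N ->
  \sum_(1 <= p < N.+1 | prime p && (p %| n)%N) ln (p%:R : R) <= ln (n%:R : R).
Proof.
move=> n0; rewrite (@ln_logn _ n (maxn n N)) ?n0 ?leq_maxl //.
have ln_ge0p p : prime p -> 0 <= ln (p%:R : R).
  by move=> pp; rewrite ln_ge0 // ler1n prime_gt0.
rewrite [leRHS](big_cat_nat (n := N.+1)) ?ltnS ?leq_maxr //=.
rewrite ler_wpDr //; first by apply: sumr_ge0 => p pp; rewrite mulr_ge0 ?ln_ge0p.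
rewrite big_mkcondr; apply: ler_sum => p pp.
case: ifPn => [pn|_]; last by rewrite mulr_ge0 // ln_ge0p.
by rewrite ler_peMl ?ln_ge0p // ler1n logn_gt0 mem_primes pp n0.
Qed.

Lemma ln2_le1 (R : realType) : ln (2 : R) <= 1.
Proof. by have := @le_ln1Dx R 1; rewrite (_ : 1 + 1 = 2); [apply; lra|lra]. Qed.

(** The binomial coefficients at m and m+1 are equal, and both occur in the expansion of (1 +
    1)^(2m+1). *)
Lemma central_bin_le (m : nat) : ('C(m.*2.+1, m) <= 2 ^ m.*2)%N.
Proof.
have lt1 : (m < m.*2.+2)%N by lia.
have lt2 : (m.+1 < m.*2.+2)%N by lia.
have := Pascal 1 1 m.*2.+1.
under eq_bigr do rewrite !exp1n !muln1.
rewrite (bigD1 (Ordinal lt1)) //= (bigD1 (Ordinal lt2)) /=; last first.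
  by rewrite -val_eqE /=; lia.
have -> : 'C(m.*2.+1, m.+1) = 'C(m.*2.+1, m).
  by rewrite -bin_sub; [congr 'C(_, _); lia|lia].
rewrite (_ : 1 + 1 = 2)%N // expnS; lia.
Qed.

Lemma prime_dvd_fact (p m : nat) : prime p -> (p %| m`!)%N -> (p <= m)%N.
Proof.
move=> pp; elim: m => [|m IH]; first by rewrite fact0 dvdn1 => /eqP p1; rewrite p1 in pp.
by rewrite factS Euclid_dvdM // => /orP[/dvdn_leq -> //|/IH]; lia.
Qed.

(* The primes in (m+1, 2m+1] divide the binomial coefficient C(2m+1, m). *)
Lemma theta_le (R : realType) (N : nat) :
  \sum_(1 <= p < N.+1 | prime p) ln (p%:R : R) <= 2 * N%:R.
Proof.
elim/ltn_ind: N => N IH.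
have [N2|N2] := leqP N 2.
  case: N N2 {IH} => [|[|[|//]]] _; first by rewrite big_geq.
    by rewrite big_mkcond big_nat1 /= mulr1.
  rewrite big_mkcond big_ltn // big_nat1 /= add0r.
  by apply: le_trans (ln2_le1 R) _; lra.
have [oN|eN] := boolP (odd N); last first.
  case: N IH N2 eN => // N IH N2 eN.
  rewrite big_mkcond big_nat_recr //= -big_mkcond.
  have /negbTE -> : ~~ prime N.+1.
    by apply/negP => /even_prime[|]; [lia|rewrite (negbTE eN)].
  rewrite addr0; apply: le_trans (IH N _) _ => //.
  by rewrite ler_pM2l // ler_nat.
have [m Nm] : exists m, N = m.*2.+1.
  by exists N./2; rewrite -[LHS]odd_double_half oN.
subst N.
rewrite (big_cat_nat (n := m.+2)) //=; last by lia.
have {}IH := IH m.+1.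
have : \sum_(m.+2 <= p < m.*2.+2 | prime p) ln (p%:R : R) <= 2 * m%:R.
  have b0 : (0 < 'C(m.*2.+1, m))%N by rewrite bin_gt0; lia.
  apply: (@le_trans _ _ (ln (('C(m.*2.+1, m))%:R : R))).
    apply: le_trans (@sum_ln_primes_le R m.*2.+1 _ b0).
    rewrite [leRHS](big_cat_nat (n := m.+2)) //=; last by lia.
    rewrite ler_wpDl //.
      apply: sumr_ge0 => p /andP[pp _].
      by rewrite ln_ge0 // ler1n prime_gt0.
    rewrite le_eqVlt; apply/orP; left; apply/eqP.
    rewrite big_nat_cond [RHS]big_nat_cond; apply: eq_bigl => p.
    have [pp|] := boolP (prime p); rewrite ?andbF ?andbT //=.
    have [/andP[mp pm]|//] := boolP (m.+2 <= p < m.*2.+2)%N.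
    (* Such a p is one of the factors of the falling factorial, which equals the binomial
       coefficient times m!; being larger than m, it cannot divide m!. *)
    have : (p %| m.*2.+1 ^_ m)%N.
      rewrite ffact_prod.
      have lt1 : (m.*2.+1 - p < m)%N by lia.
      rewrite (bigD1 (Ordinal lt1)) //= dvdn_mulr //.
      by rewrite (_ : _ - _ = p)%N //; lia.
    rewrite -bin_ffact Euclid_dvdM // => /orP[->//|].
    by move=> /(prime_dvd_fact pp); lia.
  apply: (@le_trans _ _ (ln ((2 ^ m.*2)%:R : R))).
    by rewrite ler_ln ?posrE ?ltr0n ?expn_gt0 // ler_nat central_bin_le.
  rewrite natrX lnXn // -[leLHS]mulr_natr.
  apply: (@le_trans _ _ (1 * m.*2%:R)); first by rewrite ler_wpM2r ?ln2_le1.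
  by rewrite mul1r -muln2 natrM mulrC.
move=> h; have {}IH := IH ltac:(lia).
apply: le_trans (lerD IH h) _.
rewrite -mulrDr -natrD ler_pM2l // ler_nat; lia.
Qed.

(** Counting the multiples of p up to N turns the sum of ln p * floor(N/p) into a sum over n <= N of
    the ln p with p | n, which is at most the sum of ln n. The factor 2 pays for replacing N/p by
    its floor, which is at least half of it when p <= N. *)
Lemma sum_ln_div_le (R : realType) (N : nat) : (0 < N)%N ->
  \sum_(1 <= p < N.+1 | prime p) ln (p%:R : R) / p%:R <= 2 * ln (N%:R : R).
Proof.
move=> N0.
have N0' : 0 < N%:R :> R by rewrite ltr0n.
rewrite -(ler_pM2l N0') mulr_sumr.
suff h : \sum_(1 <= p < N.+1 | prime p) ln (p%:R : R) * (N %/ p)%:R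
    <= N%:R * ln (N%:R : R).
  rewrite mulrCA; apply: le_trans (ler_wpM2l _ h) => //.
  rewrite mulr_sumr big_nat_cond [leRHS]big_nat_cond.
  apply: ler_sum => p /andP[/andP[p1 pN] pp].
  have p0 : 0 < p%:R :> R by rewrite ltr0n.
  rewrite [leRHS]mulrCA [leLHS]mulrCA ler_wpM2l ?ln_ge0 ?ler1n //.
  rewrite ler_pdivrMr // -!natrM ler_nat.
  have := divn_eq N p; have := ltn_pmod N p1; have : (0 < N %/ p)%N by rewrite divn_gt0.
  nia.
apply: (@le_trans _ _ (\sum_(1 <= n < N.+1) ln (n%:R : R))).
  apply: (@le_trans _ _ (\sum_(1 <= n < N.+1)
     \sum_(1 <= p < N.+1 | prime p && (p %| n)%N) ln (p%:R : R))).
    under [leRHS]eq_bigr do rewrite big_mkcondr.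
    rewrite exchange_big /= le_eqVlt; apply/orP; left; apply/eqP.
    apply: eq_bigr => p pp; rewrite -big_mkcond /=.
    under eq_bigl do rewrite -[(_ %| _)%N]andbT.
    rewrite (@sum_multiples _ xpredT (fun=> ln p%:R)) ?prime_gt0 //.
    by rewrite sumr_const_nat subn1 /= mulr_natr.
  by apply: ler_sum_nat => n /andP[n1 _]; exact: sum_ln_primes_le.
have -> : N%:R * ln (N%:R : R) = \sum_(1 <= n < N.+1) ln (N%:R : R).
  by rewrite sumr_const_nat subn1 mulr_natl.
apply: ler_sum_nat => n /andP[n1 nN].
by rewrite ler_ln ?posrE ?ltr0n // ler_nat.
Qed.

(** * Smooth sums and Euler products *)

Lemma pnat_belowS (Q : nat_pred) (M n : nat) : (0 < n)%N ->
  (M \in Q -> prime M) ->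
  [pred p | (p \in Q) && (p < M.+1)%N].-nat n && ~~ ((M \in Q) && (M %| n)%N) =
  [pred p | (p \in Q) && (p < M)%N].-nat n.
Proof.
move=> n0 hM; apply/idP/idP.
  move=> /andP[/(pnatP _ n0) h Mn]; apply/(pnatP _ n0) => p pp pn.
  have := h p pp pn; rewrite !inE ltnS leq_eqVlt => /andP[pQ].
  rewrite pQ => /orP[/eqP pM|->//].
  by move: Mn; rewrite -pM pQ pn.
move=> /(pnatP _ n0) h; apply/andP; split.
  apply/(pnatP _ n0) => p pp pn.
  by have := h p pp pn; rewrite !inE => /andP[-> /ltnW].
apply/negP => /andP[MQ Mn].
by have := h M (hM MQ) Mn; rewrite !inE ltnn andbF.
Qed.

(* Removing the largest prime M splits the sum as f(M+1) <= f(M) + w(M) f(M+1),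
   so the Euler product bound needs no infinite series. *)
Lemma smooth_sum_le (R : realType) (w : nat -> R) (Q : nat_pred) (N M : nat) :
  (forall n, 0 <= w n) -> w 1%N = 1 ->
  (forall m n, w (m * n)%N = w m * w n) ->
  (forall p, p \in Q -> prime p /\ w p <= 1) ->
  (\sum_(1 <= n < N.+1 | [pred p | (p \in Q) && (p < M)%N].-nat n) w n) *
    \prod_(0 <= p < M | p \in Q) (1 - w p) <= 1.
Proof.
move=> w0 w1 wM hQ; elim: M => [|M IH].
  rewrite [X in _ * X]big_geq // mulr1.
  case: N => [|N]; first by rewrite big_geq ?ler01.
  rewrite big_ltn_cond // big_nat_cond big_pred0 ?addr0 ?w1; first by case: (_.-nat _); rewrite ?ler01.
  move=> n; apply/negP => /andP[/andP[n2 _]] /(pnatP _ (ltnW n2)) h.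
  have := h (pdiv n) (pdiv_prime n2) (pdiv_dvd n).
  by rewrite inE /= ltn0 andbF.
set A := [pred p | (p \in Q) && (p < M.+1)%N].
rewrite [X in _ * X]big_mkcond big_nat_recr //= -big_mkcond /=.
have eA n : (1 <= n < N.+1)%N ->
    A.-nat n && ~~ ((M \in Q) && (M %| n)%N) =
    [pred p | (p \in Q) && (p < M)%N].-nat n.
  by move=> /andP[n1 _]; apply: pnat_belowS => // /hQ[].
have [MQ|MQ] := boolP (M \in Q); last first.
  rewrite mulr1; apply: le_trans IH.
  rewrite ler_wpM2r ?prodr_ge0 //; first by move=> p /hQ[_]; rewrite subr_ge0.
  rewrite le_eqVlt; apply/orP; left; apply/eqP.
  by apply: congr_big_nat => // n /eA; rewrite (negbTE MQ) andbT.
have [pM wM1] := hQ M MQ.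
rewrite mulrA mulrAC; set pr := \prod_(_ <= _ < _ | _) _.
have pr0 : 0 <= pr by apply: prodr_ge0 => p /hQ[_]; rewrite subr_ge0.
apply: le_trans IH; apply: ler_wpM2r => //.
set f := \sum_(_ <= _ < _ | _) _.
rewrite mulrBr mulr1 lerBlDr mulrC.
rewrite {1}/f (bigID (fun n => (M %| n)%N)) /= addrC lerD //.
  rewrite le_eqVlt; apply/orP; left; apply/eqP.
  by apply: congr_big_nat => // n /eA <-; rewrite MQ.
under eq_bigl do rewrite andbC.
rewrite (@sum_multiples _ A.-nat w) ?prime_gt0 //.
rewrite mulr_sumr [leRHS](big_cat_nat (n := (N %/ M).+1)) //=; last first.
  by rewrite ltnS leq_div.
rewrite ler_wpDr //; first by apply: sumr_ge0 => n _; exact: mulr_ge0.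
rewrite big_mkcond [leRHS]big_mkcond; apply: ler_sum => n _.
by rewrite pnatM wM; case: (A.-nat M); case: (A.-nat n); rewrite //= mulr_ge0.
Qed.

(** A truncation N that works for M also works for the next product once enlarged to M * N: the old
    terms remain as the n not divisible by M, and the multiples M * n with n <= N supply [w M] times
    the old sum. *)
Lemma prod_le_smooth_sum (R : realType) (w : nat -> R) (M : nat) :
  (forall n, 0 <= w n) -> w 1%N = 1 ->
  (forall m n, w (m * n)%N = w m * w n) ->
  exists N : nat, \prod_(0 <= p < M | prime p) (1 + w p) <=
    \sum_(1 <= n < N.+1 | [pred p | prime p && (p < M)%N].-nat n) w n.
Proof.
move=> w0 w1 wM; elim: M => [|M [N IH]].
  by exists 1%N; rewrite big_geq // big_mkcond big_nat1 /= w1.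
set A := [pred p | prime p && (p < M.+1)%N].
have eA n : (1 <= n)%N -> A.-nat n && ~~ (prime M && (M %| n)%N) =
    [pred p | prime p && (p < M)%N].-nat n.
  by move=> n1; exact: (@pnat_belowS [pred p | prime p]).
rewrite big_mkcond big_nat_recr //= -big_mkcond /=.
have [pM|npM] := boolP (prime M); last first.
  exists N; rewrite mulr1; apply: le_trans IH _.
  rewrite le_eqVlt; apply/orP; left; apply/eqP.
  by apply: congr_big_nat => // n /andP[/eA + _]; rewrite (negbTE npM) andbT.
have M0 := prime_gt0 pM.
exists (M * N)%N; rewrite mulrDr mulr1.
rewrite [leRHS](bigID (fun n => (M %| n)%N)) /= [leLHS]addrC lerD //.
- under [leRHS]eq_bigl do rewrite andbC.
  rewrite (@sum_multiples _ A.-nat w) // mulKn //.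
  rewrite mulrC; apply: le_trans (ler_wpM2l (w0 M) IH) _.
  rewrite mulr_sumr [leLHS]big_mkcond [leRHS]big_mkcond.
  apply: ler_sum_nat => n /andP[n0 nN].
  rewrite pnatM wM -(eA _ n0).
  have -> : A.-nat M by rewrite pnatE // !inE pM ltnSn.
  by case: (A.-nat n) => //=; case: ifP; rewrite // mulr_ge0.
- apply: le_trans IH _.
  rewrite [leRHS](big_cat_nat (n := N.+1)) //=; last by rewrite ltnS leq_pmull.
  rewrite ler_wpDr //; first by apply: sumr_ge0.
  rewrite le_eqVlt; apply/orP; left; apply/eqP.
  by apply: congr_big_nat => // n /andP[/eA <- _]; rewrite pM.
Qed.

(** Comparison with the integral of y^(-1-s), in telescoping form: the induction carries the
    stronger bound 1 + (1 - N^(-s))/s. *)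
Lemma zeta_partial_le (R : realType) (s : R) (N : nat) : 0 < s ->
  \sum_(1 <= n < N.+1) n%:R `^ (- (1 + s)) <= 1 + s^-1.
Proof.
move=> s0.
suff h : (0 < N)%N -> \sum_(1 <= n < N.+1) n%:R `^ (- (1 + s)) <=
    1 + s^-1 - s^-1 * N%:R `^ (- s).
  case: N h => [|N] h; first by rewrite big_geq // addr_ge0 // invr_ge0 ltW.
  by apply: le_trans (h _) _ => //; rewrite gerBl mulr_ge0 ?powR_ge0 // invr_ge0 ltW.
elim: N => // -[|N] IH _.
  by rewrite big_nat1 powR1; lra.
rewrite big_nat_recr //=; apply: le_trans (lerD (IH isT) (lexx _)) _.
set n := N.+2.
have n0 : 0 < n%:R :> R by rewrite ltr0n.
suff : s * n%:R `^ (- (1 + s)) <= N.+1%:R `^ (- s) - n%:R `^ (- s).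
  by rewrite -ler_pdivlMl // mulrBr; lra.
rewrite opprD powRD; last by rewrite (gt_eqF n0) implybT.
rewrite powR_inv1 ?(ltW n0) // mulrA.
have -> : (N.+1%:R : R) = n%:R * (1 - n%:R^-1).
  by rewrite mulrBr mulfV ?gt_eqF // mulr1 /n -[N.+2]addn1 natrD addrK.
have d0 : 0 < 1 - n%:R^-1 :> R.
  by rewrite subr_gt0 invf_lt1 // ltr1n.
rewrite powRM ?(ltW n0) ?(ltW d0) //.
rewrite -[X in _ <= _ - X]mulr1 -mulrBr mulrC.
rewrite ler_wpM2l ?powR_ge0 // lerBrDl /powR gt_eqF //.
apply: le_trans (expR_ge1Dx _) _.
rewrite ler_expR mulNr -mulrN ler_pM2l // lerNr.
by apply: le_ln1Dx; rewrite ltrN2 invf_lt1 // ltr1n.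
Qed.

(** The product of 1 - 1/n^2 over all integers 2 <= n < M telescopes to M / (2(M-1)) > 1/2, and
    keeping only the primes makes it larger. *)
Lemma prod_1B_sqr_ge (R : realType) (M : nat) :
  2^-1 <= \prod_(0 <= p < M | prime p) (1 - (p%:R : R)^-1 ^+ 2).
Proof.
have [M2|M2] := ltnP M 2.
  rewrite big_nat_cond big_pred0 ?invf_le1 ?ler1n // => p.
  by apply/negP => /andP[/andP[_ pM] /prime_gt1]; lia.
suff h : M%:R <= 2 * (M%:R - 1) * \prod_(0 <= p < M | prime p) (1 - (p%:R : R)^-1 ^+ 2).
  have : 2 <= M%:R :> R by rewrite (ler_nat R 2).
  move: h; set p := \prod_(_ <= _ < _ | _) _; set m := M%:R.
  by move=> h m2; rewrite -(ler_pM2l (x := 2 * (m - 1))); nra.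
elim: M M2 => // M IH M2.
have [M1|M1] := ltnP M 2.
  have -> : M = 1%N by lia.
  by rewrite big_mkcond big_ltn // big_nat1 /=; lra.
have {}IH := IH M1.
rewrite big_mkcond big_nat_recr //= -big_mkcond /=.
have m2 : 2 <= M%:R :> R by rewrite (ler_nat R 2).
rewrite -[M.+1]addn1 natrD; move: IH m2.
set p := \prod_(_ <= _ < _ | _) _; set m := (M%:R : R) => IH m2.
have p0 : 0 <= p by nra.
have m0 : m != 0 by rewrite gt_eqF //; lra.
suff h : (m + 1) <= 2 * m * p * (1 - m^-1 ^+ 2).
  case: ifP => _; first by rewrite addrK mulrA.
  rewrite addrK mulr1; apply: le_trans h _; rewrite ler_piMr //; first nra.
  by rewrite gerBl exprn_ge0 // invr_ge0; lra.
have e : m * (m * m^-1 ^+ 2) = 1 by rewrite expr2; field.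
rewrite -(ler_pM2l (x := m)); last lra.
have -> : m * (2 * m * p * (1 - m^-1 ^+ 2)) = 2 * p * (m * m - m * (m * m^-1 ^+ 2)) by ring.
by rewrite e; nra.
Qed.

(* Compare with zeta(s) at s = 1 + 1/(1 + ln N): the ratio of the factors is
   controlled by [sum_ln_div_le] alone. *)
Lemma mertens_prod_ge (R : realType) (N : nat) : (0 < N)%N ->
  1 <= 4 * expR 2 * (1 + ln (N%:R : R)) *
       \prod_(0 <= p < N.+1 | prime p) (1 - (p%:R : R)^-1).
Proof.
move=> N0.
have lN : 0 <= ln (N%:R : R) by rewrite ln_ge0 // ler1n.
set L := 1 + ln N%:R; have L0 : 1 <= L by rewrite lerDl.
set s := L^-1.
have s0 : 0 < s by rewrite invr_gt0; lra.
pose w n : R := n%:R `^ (- (1 + s)).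
have w0 n : 0 <= w n by exact: powR_ge0.
have [K hK] := @prod_le_smooth_sum R w N.+1 w0 ltac:(by rewrite /w powR1) ltac:(
  by move=> m n; rewrite /w natrM powRM).
have {}hK : \prod_(0 <= p < N.+1 | prime p) (1 + w p) <= 1 + L.
  apply: le_trans hK _; rewrite -[L]invrK.
  apply: le_trans (@zeta_partial_le R s K s0).
  by rewrite big_mkcond; apply: ler_sum => n _; case: ifP.
(* Replacing [w p] by 1/p costs at most s * ln p / p per prime. Over all p <= N these losses add up
   to at most 2 s ln N <= 2, by the choice s = 1/(1 + ln N). *)
have {}hK : \prod_(0 <= p < N.+1 | prime p) (1 + (p%:R : R)^-1) <= (1 + L) * expR 2.
  apply: (@le_trans _ _ (\prod_(0 <= p < N.+1 | prime p)
      ((1 + w p) * expR (s * (ln p%:R / p%:R))))).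
    apply: ler_prod => p pp; rewrite addr_ge0 ?invr_ge0 //=.
    have p0 : 0 < p%:R :> R by rewrite ltr0n prime_gt0.
    apply: (@le_trans _ _ ((1 + w p) * (1 + s * (ln p%:R / p%:R)))); last first.
      by rewrite ler_wpM2l ?addr_ge0 // expR_ge1Dx.
    have lp : 0 <= ln (p%:R : R) by rewrite ln_ge0 // ler1n prime_gt0.
    have : p%:R^-1 - s * (ln p%:R / p%:R) <= w p.
      rewrite /w opprD powRD ?powR_inv1 ?(ltW p0) //; last by rewrite (gt_eqF p0) implybT.
      have -> : p%:R^-1 - s * (ln p%:R / p%:R) = p%:R^-1 * (1 - s * ln (p%:R : R)).
        by ring.
      rewrite ler_wpM2l ?invr_ge0 ?(ltW p0) // /powR (gt_eqF p0).
      by apply: le_trans (expR_ge1Dx _); rewrite mulNr.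
    have a0 : 0 <= s * (ln (p%:R : R) / p%:R).
      by rewrite mulr_ge0 ?divr_ge0 ?(ltW p0) // ltW.
    by have := w0 p; nra.
  rewrite big_split /=; apply: ler_pM => //.
  - by apply: prodr_ge0 => p _; rewrite addr_ge0.
  - by apply: prodr_ge0 => p _; rewrite expR_ge0.
  rewrite -expR_sum ler_expR -mulr_sumr.
  have h := @sum_ln_div_le R N N0.
  rewrite big_ltn_cond //=.
  apply: le_trans (ler_wpM2l (ltW s0) h) _.
  by rewrite /s ler_pdivrMl; [rewrite /L; lra|lra].
(* The upper bound for the product of 1 + 1/p becomes a lower bound for that of 1 - 1/p, since the
   two multiply to the product of 1 - 1/p^2. *)
have : 2^-1 <= \prod_(0 <= p < N.+1 | prime p) (1 - (p%:R : R)^-1) *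
    \prod_(0 <= p < N.+1 | prime p) (1 + (p%:R : R)^-1).
  rewrite -big_split /=; apply: le_trans (prod_1B_sqr_ge R N.+1) _.
  rewrite le_eqVlt; apply/orP; left; apply/eqP; apply: eq_bigr => p _.
  by ring.
set A := \prod_(_ <= _ < _ | _) (1 - _) => hA.
have A0 : 0 <= A.
  apply: prodr_ge0 => p pp.
  by rewrite subr_ge0 invf_le1 ?ler1n ?ltr0n ?prime_gt0.
have := le_trans hA (ler_wpM2l A0 hK).
have e0 := expR_gt0 (2 : R).
have : A * ((1 + L) * expR 2) <= A * (2 * L * expR 2).
  by rewrite ler_wpM2l // ler_wpM2r ?(ltW e0) //; lra.
by lra.
Qed.

Lemma euler_prodE (R : realType) (Q : nat_pred) (t : R) : (forall p, p \in Q -> prime p) ->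
  euler_prod Q t = \prod_(0 <= p < (Num.truncn t).+1 | p \in Q) (1 - (p%:R : R)^-1).
Proof.
by move=> hQ; rewrite /euler_prod [RHS]big_ltn_cond //; case: ifP => // /hQ.
Qed.

Lemma inv_prime_itv (R : realType) (p : nat) : prime p ->
  0 < (p%:R : R)^-1 <= 2^-1.
Proof.
move=> pp; have p0 : 0 < p%:R :> R by rewrite ltr0n prime_gt0.
by rewrite invr_gt0 p0 lef_pV2 ?posrE // (ler_nat R 2) prime_gt1.
Qed.

Lemma euler_prod_gt0 (R : realType) (Q : nat_pred) (t : R) :
  (forall p, p \in Q -> prime p) -> 0 < euler_prod Q t.
Proof.
move=> hQ; rewrite /euler_prod big_seq_cond; apply: prodr_gt0 => p /andP[_ /hQ pp].
by have := inv_prime_itv R pp; lra.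
Qed.

Lemma mertens_euler_prod (R : realType) (t : R) : 1 <= t ->
  1 <= 4 * expR 2 * (1 + ln t) * euler_prod [pred p | prime p] t.
Proof.
move=> t1; rewrite euler_prodE //.
have N0 : (0 < Num.truncn t)%N by rewrite truncn_gt0.
apply: le_trans (@mertens_prod_ge R _ N0) _.
rewrite ler_wpM2r //.
  apply: prodr_ge0 => p pp.
  by rewrite subr_ge0 invf_le1 ?ler1n ?ltr0n ?prime_gt0.
rewrite ler_wpM2l ?mulr_ge0 ?expR_ge0 // lerD2l ler_ln ?posrE ?ltr0n //.
  by rewrite truncn_le; lra.
by lra.
Qed.

(** * Hall's bound with a Rankin twist *)

Lemma le_sum_nat_sub (R : numDomainType) (N K : nat) (A B : pred nat) (F : nat -> R) :
  (forall p, (1 <= p < N)%N -> A p -> B p && (p < K)%N) ->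
  (forall p, B p -> 0 <= F p) ->
  \sum_(1 <= p < N | A p) F p <= \sum_(1 <= p < K | B p) F p.
Proof.
move=> hAB F0.
rewrite (big_nat_widen _ _ (maxn N K)) ?leq_maxl //.
rewrite [leRHS](big_nat_widen _ _ (maxn N K)) ?leq_maxr //.
rewrite [leLHS]big_mkcond [leRHS]big_mkcond /=; apply: ler_sum_nat => p /andP[p1 _].
case: ifP => [/andP[Ap pN]|_]; first by rewrite hAB // p1.
by case: ifP => // /andP[/F0].
Qed.

(** The first power is kept apart so that Chebyshev's bound can sum it. Higher powers occur only for
    p <= sqrt M, few enough primes that each may cost ln M. *)
Lemma prime_power_log_sum_le (R : realType) (p N M : nat) : prime p -> (0 < M)%N ->
  \sum_(1 <= k < N.+1 | (p ^ k <= M)%N) ln (p%:R : R) <=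
  if (p <= M)%N then ln p%:R + (if (p * p <= M)%N then ln M%:R else 0) else 0.
Proof.
move=> pp M0; have p1 := prime_gt1 pp; have p0 := prime_gt0 pp.
have lp : 0 <= ln (p%:R : R) by rewrite ln_ge0 // ler1n.
case: ifP => pM; last first.
  rewrite big_nat_cond big_pred0 // => k; apply/negP => /andP[/andP[k1 _]].
  by rewrite leqNgt => /negP; apply; apply: (@leq_trans p); [lia|rewrite -{1}[p]expn1 leq_exp2l].
set c := trunc_log p M.
apply: (@le_trans _ _ (\sum_(1 <= k < c.+1) ln (p%:R : R))).
  apply: le_sum_nat_sub => // k _ kM.
  by rewrite /= ltnS trunc_log_max.
rewrite sumr_const_nat subn1 /=.
case: ifP => ppM.
  rewrite -lnXn ?ltr0n // -natrX.
  apply: (@le_trans _ _ (ln M%:R)); last by rewrite lerDr.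
  rewrite ler_ln ?posrE ?ltr0n ?expn_gt0 ?p0 // ler_nat.
  exact: trunc_logP.
rewrite addr0 -[leRHS]mulr1n ler_wpMn2l //.
rewrite leqNgt; apply/negP => c2.
have cM := trunc_logP p1 M0.
move/negbT: ppM => /negP; apply; rewrite -/(p ^ 2)%N; apply: leq_trans cM.
by rewrite -[(p * p)%N]/(p ^ 2)%N leq_exp2l.
Qed.

Lemma sum_ln_le_sum_prime_powers (R : realType) (Q : nat_pred) (N : nat) :
  \sum_(1 <= n < N.+1 | Q.-nat n) ln (n%:R : R) <=
  \sum_(1 <= m < N.+1 | Q.-nat m) \sum_(1 <= p < N.+1 | (p \in Q) && prime p)
    \sum_(1 <= k < N.+1 | (p ^ k <= N %/ m)%N) ln (p%:R : R).
Proof.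
have lp p : prime p -> 0 <= ln (p%:R : R).
  by move=> pp; rewrite ln_ge0 // ler1n prime_gt0.
apply: (@le_trans _ _ (\sum_(1 <= n < N.+1 | Q.-nat n) \sum_(1 <= p < N.+1 | prime p)
    \sum_(1 <= k < N.+1 | (p ^ k %| n)%N) ln (p%:R : R))).
  rewrite [leLHS]big_mkcond [leRHS]big_mkcond /=; apply: ler_sum_nat => n /andP[n1 nN].
  case: ifP => // _; rewrite (@ln_logn _ n N) ?n1 //.
  apply: ler_sum => p pp; rewrite logn_count_dvd // natr_sum mulr_suml.
  rewrite [leRHS](big_cat_nat (n := n)) //=; last exact: ltnW.
  rewrite ler_wpDr //; first by apply: sumr_ge0 => k _; exact: lp.
  rewrite [leRHS]big_mkcond /=; apply: ler_sum => k _.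
  by case: (_ %| _)%N; rewrite ?mul1r ?mul0r.
rewrite exchange_big /=.
rewrite [leRHS]exchange_big /=.
apply: (@le_trans _ _ (\sum_(1 <= p < N.+1 | prime p) \sum_(1 <= k < N.+1)
    \sum_(1 <= n < N.+1 | (p ^ k %| n)%N && Q.-nat n) ln (p%:R : R))).
  rewrite le_eqVlt; apply/orP; left; apply/eqP; apply: eq_bigr => p _.
  under eq_bigr do rewrite big_mkcond.
  rewrite exchange_big /=; apply: eq_bigr => k _.
  by under [RHS]eq_bigl do rewrite andbC; rewrite [RHS]big_mkcondr.
rewrite [leRHS]big_mkcondl [leRHS]big_mkcond /=.
rewrite [leLHS]big_mkcond; apply: ler_sum => p _.
case: ifP => // pp; have p0 := prime_gt0 pp.
(* Since k >= 1, a multiple n = p^k m has all its primes in Q only if p itself is in Q; then so has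
   m, and n <= N reads p^k <= N/m. *)
apply: (@le_trans _ _ (\sum_(1 <= k < N.+1) if p \in Q then
   \sum_(1 <= m < N.+1 | Q.-nat m && (p ^ k <= N %/ m)%N) ln (p%:R : R) else 0)).
  apply: ler_sum_nat => k /andP[k1 kN].
  rewrite (@sum_multiples _ Q.-nat (fun=> ln (p%:R : R))) ?expn_gt0 ?p0 //.
  case: ifP => pQ; last first.
    rewrite big_pred0 // => m.
    by rewrite pnatM pnatX pnatE // pQ; case: k k1 {kN}.
  apply: le_sum_nat_sub => [m /andP[m1 mN]|m _]; last exact: lp.
  rewrite pnatM pnatX pnatE // pQ /= => ->.
  move: mN; rewrite !ltnS !leq_divRL ?expn_gt0 ?p0 // mulnC => mN.
  by rewrite mN /=; apply: leq_trans mN; rewrite leq_pmull ?expn_gt0 ?p0.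
case: ifP => pQ; last by rewrite big1.
rewrite [leRHS](eq_bigr (fun m => \sum_(1 <= k < N.+1) if (p ^ k <= N %/ m)%N then ln p%:R else 0)); last first.
  by move=> m _; rewrite big_mkcond.
rewrite exchange_big /=; apply: ler_sum => k _.
by rewrite big_mkcondr.
Qed.

(** This interpolation is how the twist enters: sums over primes bounded both by z and by y are
    charged z^d y^(1-d) instead of y. *)
Lemma min_le_powR (R : realType) (d y z b : R) : 0 <= d <= 1 -> 0 <= b -> b <= z -> b <= y ->
  b <= z `^ d * y `^ (1 - d).
Proof.
move=> /andP[d0 d1] b0 bz yz.
have [->|bn0] := eqVneq b 0; first by rewrite mulr_ge0 ?powR_ge0.
have e : b = b `^ d * b `^ (1 - d).
  by rewrite -powRD ?bn0 ?implybT // (_ : d + (1 - d) = 1) ?powRr1 //; ring.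
rewrite {1}e.
apply: ler_pM; rewrite ?powR_ge0 //; apply: ge0_ler_powR;
  rewrite ?nnegrE ?subr_ge0 //; exact: le_trans b0 _.
Qed.

Lemma one_ln_le_sqrt (R : realType) (y : R) : 0 < y -> 1 + ln y <= 2 * y `^ 2^-1.
Proof.
move=> y0; have h0 : 0 < y `^ 2^-1 by exact: powR_gt0.
have e : ln y = 2 * ln (y `^ 2^-1) by rewrite ln_powR mulrA mulfV ?mul1r.
have : ln (y `^ 2^-1) <= y `^ 2^-1 - 1.
  by have := @le_ln1Dx R (y `^ 2^-1 - 1); rewrite [1 + _]addrC subrK; apply; lra.
by lra.
Qed.

Lemma ln_le_4_powR (R : realType) (y e : R) : 1 <= y -> 4^-1 <= e -> ln y <= 4 * y `^ e.
Proof.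
move=> y1 e4.
have e0 : ln y = 4 * ln (y `^ 4^-1) by rewrite ln_powR mulrA mulfV ?mul1r.
rewrite e0 ler_pM2l //; apply: (@le_trans _ _ (y `^ 4^-1)).
  by apply/ltW/ln_sublinear; apply: powR_gt0; lra.
by apply: ler_powR.
Qed.

(** The constant is 6 = 2 + 4: Chebyshev's bound for first powers up to min(z, y), and, for the
    higher powers, at most min(z, sqrt y) primes costing ln y each. *)
Lemma prime_power_sum_le (R : realType) (Q : nat_pred) (N m : nat) (z d y : R) :
  (forall p, p \in Q -> p%:R <= z) -> 1 <= z -> 0 <= d <= 2^-1 ->
  1 <= y -> (0 < N %/ m)%N -> (N %/ m)%:R <= y ->
  \sum_(1 <= p < N.+1 | (p \in Q) && prime p)
    \sum_(1 <= k < N.+1 | (p ^ k <= N %/ m)%N) ln (p%:R : R) <=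
  6 * (z `^ d * y `^ (1 - d)).
Proof.
move=> hQ z1 /andP[d0 d1] y1; set M := (N %/ m)%N => M0 My.
have M1 : 1 <= M%:R :> R by rewrite ler1n.
have lp p : prime p -> 0 <= ln (p%:R : R).
  by move=> pp; rewrite ln_ge0 // ler1n prime_gt0.
apply: (@le_trans _ _ (\sum_(1 <= p < N.+1 | (p \in Q) && prime p)
  ((if (p <= M)%N then ln p%:R else 0) + (if (p * p <= M)%N then ln y else 0)))).
  apply: ler_sum => p /andP[pQ pp].
  apply: le_trans (@prime_power_log_sum_le R p N M pp M0) _.
  case: ifP => pM; last by rewrite add0r; case: ifP => // _; rewrite ln_ge0.
  by rewrite lerD2l; case: ifP => // _; rewrite ler_ln ?posrE //; lra.
rewrite big_split /=.
have -> : 6 * (z `^ d * y `^ (1 - d)) = 2 * (z `^ d * y `^ (1 - d)) + 4 * (z `^ d * y `^ (1 - d)) by ring.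
apply: lerD.
  set b := Num.min z y.
  have b0 : 0 <= b by rewrite le_min; lra.
  apply: (@le_trans _ _ (\sum_(1 <= p < (Num.truncn b).+1 | prime p) ln (p%:R : R))).
    rewrite -big_mkcondr /=; apply: le_sum_nat_sub => // p _ /andP[/andP[pQ pp] pM].
    rewrite pp /= ltnS truncn_ge_nat // le_min hQ //=.
    by apply: le_trans My; rewrite ler_nat.
  apply: le_trans (theta_le R _) _; rewrite ler_pM2l //.
  apply: (@le_trans _ _ b); first by rewrite truncn_le.
  by apply: min_le_powR => //; rewrite ?ge_min ?lexx ?orbT //; lra.
set b := Num.min z (y `^ 2^-1).
have b0 : 0 <= b by rewrite le_min powR_ge0; lra.
apply: (@le_trans _ _ (\sum_(1 <= p < (Num.truncn b).+1 | predT p) ln y)).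
  rewrite -big_mkcondr /=; apply: le_sum_nat_sub => [p _ /andP[/andP[pQ pp] pM]|p _].
    rewrite /= ltnS truncn_ge_nat // le_min hQ //=.
    have : (p%:R ^+ 2 : R) `^ 2^-1 <= y `^ 2^-1.
      apply: ge0_ler_powR; rewrite ?nnegrE ?invr_ge0 ?exprn_ge0 //; first lra.
      by apply: le_trans My; rewrite expr2 -natrM ler_nat.
    by rewrite -powR_mulrn // -powRrM mulfV // powRr1.
  by rewrite ln_ge0.
rewrite sumr_const_nat subn1 /= -[leLHS]mulr_natl.
have hb : (Num.truncn b)%:R <= z `^ d * y `^ (2^-1 * (1 - d)).
  apply: (@le_trans _ _ b); first by rewrite truncn_le.
  rewrite powRrM.
  by apply: min_le_powR => //; rewrite ?ge_min ?lexx ?orbT //; lra.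
(* The restriction d <= 1/2 makes this exponent at least 1/4. *)
have l4 : ln y <= 4 * y `^ (2^-1 * (1 - d)) by apply: ln_le_4_powR => //; lra.
apply: le_trans (ler_pM _ _ hb l4) _ => //; first by rewrite ln_ge0.
rewrite mulrCA ler_pM2l // -mulrA ler_wpM2l ?powR_ge0 //.
by rewrite -powRD; [rewrite (_ : _ + _ = 1 - d) //; lra|rewrite (gt_eqF (lt_le_trans _ y1)) ?implybT].
Qed.

(* With d = 0 this is Hall's bound Psi(t) << (t / log t) sum 1/n; the twist by
   n^d keeps the factor 1 / log t that Rankin's trick alone would lose. *)
Lemma hall_rankin (R : realType) (Q : nat_pred) (t z d : R) :
  (forall p, p \in Q -> p%:R <= z) -> 1 <= z -> 0 <= d <= 2^-1 -> 1 <= t ->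
  (1 + ln t) * (Psi t Q)%:R <=
  8 * z `^ d * \sum_(1 <= n < (Num.truncn t).+1 | Q.-nat n) (t / n%:R) `^ (1 - d).
Proof.
move=> hQ z1 hd t1; set N := Num.truncn t.
have Nt : N%:R <= t by rewrite truncn_le; lra.
have z0 : 1 <= z `^ d by rewrite -(powRr0 z) ler_powR //; lra.
rewrite /Psi -/N natr_sum mulr_sumr.
(* Here 1 + ln t = (1 + ln(t/n)) + ln n. The first part costs 2 and the prime powers from the second
   cost 6, whence the factor 8. *)
apply: (@le_trans _ _ (\sum_(1 <= n < N.+1 | Q.-nat n) (1 + ln (t / n%:R)) +
   \sum_(1 <= n < N.+1 | Q.-nat n) ln (n%:R : R))).
  rewrite -big_split /= [leLHS]big_mkcond [leRHS]big_mkcond /=.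
  apply: ler_sum_nat => n /andP[n1 _]; case: ifP => // _.
  rewrite ln_div ?posrE ?ltr0n //; [|lra].
  by rewrite mulr1 addrA subrK.
apply: le_trans (lerD (lexx _) (@sum_ln_le_sum_prime_powers R Q N)) _.
rewrite -big_split /= mulr_sumr [leLHS]big_mkcond [leRHS]big_mkcond /=.
apply: ler_sum_nat => n /andP[n1 nN]; case: ifP => // _.
have n0 : 0 < n%:R :> R by rewrite ltr0n.
have y1 : 1 <= t / n%:R.
  by rewrite ler_pdivlMr // mul1r; apply: le_trans Nt; rewrite ler_nat.
rewrite -mulrA (_ : 8 * _ = 2 * (z `^ d * (t / n%:R) `^ (1 - d)) +
  6 * (z `^ d * (t / n%:R) `^ (1 - d))); last by ring.
apply: lerD.
  apply: le_trans (one_ln_le_sqrt _) _; first lra.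
  rewrite ler_pM2l // -[leLHS]mul1r; apply: ler_pM => //; first exact: powR_ge0.
  by apply: ler_powR => //; lra.
apply: prime_power_sum_le => //; first by rewrite divn_gt0.
rewrite ler_pdivlMr // -natrM; apply: le_trans Nt; rewrite ler_nat.
exact: leq_trunc_div.
Qed.

Lemma smooth_sum_powR_le (R : realType) (Q : nat_pred) (N : nat) (z s : R) :
  (forall p, p \in Q -> prime p /\ p%:R <= z) -> 1 <= z -> 0 <= s ->
  (\sum_(1 <= n < N.+1 | Q.-nat n) n%:R `^ (- s)) *
    \prod_(0 <= p < (Num.truncn z).+1 | p \in Q) (1 - p%:R `^ (- s)) <= 1.
Proof.
move=> hQ z1 s0.
have := @smooth_sum_le R (fun n => n%:R `^ (- s)) Q N (Num.truncn z).+1.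
have -> : \sum_(1 <= n < N.+1 |
    [pred p | (p \in Q) && (p < (Num.truncn z).+1)%N].-nat n) n%:R `^ (- s) =
    \sum_(1 <= n < N.+1 | Q.-nat n) n%:R `^ (- s).
  apply: eq_bigl => n; apply: eq_pnat => p; rewrite !inE ltnS.
  have [pQ|//] := boolP (p \in Q).
  by rewrite truncn_ge_nat ?(hQ _ pQ).2 //; lra.
apply=> [n||m n|p /hQ[pp _]]; first exact: powR_ge0.
- by rewrite powR1.
- by rewrite natrM powRM.
- split=> //; rewrite -[leRHS](powRr0 p%:R); apply: ler_powR; last by rewrite oppr_le0.
  by rewrite ler1n prime_gt0.
Qed.

(** With w = p^(d-1) <= p^(-1/2) <= 3/4, one has 1 - w >= 1/4, so the ratio of the two factors is at
    most 1 + 4(w - 1/p); and w - 1/p <= p^d * d * ln p / p by convexity of the exponential. *)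
Lemma rankin_factor_le (R : realType) (p : nat) (d : R) : prime p -> 0 <= d <= 2^-1 ->
  1 - p%:R^-1 <= (1 - p%:R `^ (- (1 - d))) *
    expR (4 * (p%:R `^ d * d * (ln p%:R / p%:R))).
Proof.
move=> pp /andP[d0 d1].
have p0 : 0 < p%:R :> R by rewrite ltr0n prime_gt0.
have p2 : 2 <= p%:R :> R by rewrite (ler_nat R 2) prime_gt1.
set w := p%:R `^ _.
have w0 : 0 <= w by exact: powR_ge0.
have ew : w = p%:R `^ d / p%:R.
  rewrite /w opprB powRD ?powR_inv1 ?(ltW p0) //.
  by rewrite (gt_eqF p0) implybT.
have pd1 : 1 <= p%:R `^ d by rewrite -[leLHS](powRr0 p%:R); apply: ler_powR => //; lra.
have wp : p%:R^-1 <= w by rewrite ew ler_peMl // invr_ge0 ltW.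
have w34 : w <= 3 / 4.
  have : w <= p%:R `^ (- 2^-1).
    rewrite /w; apply: ler_powR; lra.
  have : p%:R `^ (- 2^-1) * p%:R `^ (- 2^-1) = p%:R^-1 :> R.
    rewrite -powRD ?(gt_eqF p0) ?implybT // (_ : _ + _ = -1) ?powR_inv1 ?(ltW p0) //.
    by lra.
  have : p%:R^-1 <= 2^-1 :> R by have /andP[] := inv_prime_itv R pp.
  have := powR_ge0 (p%:R : R) (- 2^-1).
  by nra.
have h : w - p%:R^-1 <= p%:R `^ d * d * (ln p%:R / p%:R).
  rewrite ew -[X in _ - X]mul1r -mulrBl mulrA ler_wpM2r ?invr_ge0 ?(ltW p0) //.
  rewrite lerBlDr -lerBlDl /powR (gt_eqF p0).
  have := expR_ge1Dx (- (d * ln p%:R)).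
  move=> /(ler_wpM2l (expR_ge0 (d * ln p%:R))).
  by rewrite -expRD addrN expR0; lra.
apply: (@le_trans _ _ ((1 - w) * (1 + 4 * (p%:R `^ d * d * (ln p%:R / p%:R))))).
  by nra.
rewrite ler_wpM2l ?expR_ge1Dx //; lra.
Qed.

Lemma euler_prod_rankin_le (R : realType) (Q : nat_pred) (z d : R) :
  (forall p, p \in Q -> prime p /\ p%:R <= z) -> 1 <= z -> 0 <= d <= 2^-1 ->
  euler_prod Q z <=
  \prod_(0 <= p < (Num.truncn z).+1 | p \in Q) (1 - p%:R `^ (- (1 - d))) *
    expR (8 * (z `^ d * (d * ln z))).
Proof.
move=> hQ z1 hd; have /andP[d0 d1] := hd.
rewrite euler_prodE; last by move=> p /hQ[].
have zd0 : 0 <= z `^ d by exact: powR_ge0.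
apply: (@le_trans _ _ (\prod_(0 <= p < (Num.truncn z).+1 | p \in Q)
   ((1 - p%:R `^ (- (1 - d))) * expR (4 * (z `^ d * d * (ln p%:R / p%:R)))))).
  apply: ler_prod => p /hQ[pp pz]; apply/andP; split.
    by have := inv_prime_itv R pp; lra.
  apply: le_trans (rankin_factor_le pp hd) _.
  have p1 : 1 <= p%:R :> R by rewrite ler1n prime_gt0.
  apply: ler_wpM2l.
    rewrite subr_ge0 -[leRHS](powRr0 p%:R); apply: ler_powR => //; lra.
  rewrite ler_expR ler_pM2l // ler_wpM2r ?divr_ge0 ?ln_ge0 //.
  rewrite ler_wpM2r //; apply: ge0_ler_powR; rewrite ?nnegrE //; lra.
rewrite big_split /= ler_wpM2l //.
  apply: prodr_ge0 => p /hQ[pp _]; rewrite subr_ge0 -[leRHS](powRr0 p%:R).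
  by apply: ler_powR; rewrite ?ler1n ?prime_gt0 //; lra.
rewrite -expR_sum ler_expR -mulr_sumr -mulr_sumr.
have N0 : (0 < Num.truncn z)%N by rewrite truncn_gt0.
have := @sum_ln_div_le R _ N0.
have : ln (Num.truncn z)%:R <= ln z.
  by rewrite ler_ln ?posrE ?ltr0n ?truncn_le //; lra.
set S := \sum_(1 <= p < _ | prime p) _ => h1 h2.
have : \sum_(0 <= p < (Num.truncn z).+1 | p \in Q) ln (p%:R : R) / p%:R <= S.
  rewrite big_ltn_cond //; case: ifP => [/hQ[]//|_].
  apply: le_sum_nat_sub => p; first by move=> /andP[_ ->] /hQ[->].
  by move=> pp; rewrite divr_ge0 // ln_ge0 // ler1n prime_gt0.
set S' := \sum_(0 <= p < _ | _) _ => h3.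
have : z `^ d * d * S' <= z `^ d * d * (2 * ln z).
  by rewrite ler_wpM2l ?mulr_ge0 //; lra.
by lra.
Qed.

Lemma psi_rankin (R : realType) (Q : nat_pred) (t z d : R) :
  (forall p, p \in Q -> prime p /\ p%:R <= z) -> 1 <= z -> 0 <= d <= 2^-1 -> 1 <= t ->
  (1 + ln t) * (Psi t Q)%:R * euler_prod Q z <=
  8 * t * (t `^ (- d) * (z `^ d * expR (8 * (z `^ d * (d * ln z))))).
Proof.
move=> hQ z1 hd t1; have /andP[d0 d1] := hd.
have e0 : 0 < euler_prod Q z by apply: euler_prod_gt0 => p /hQ[].
apply: le_trans (ler_wpM2r (ltW e0) (@hall_rankin R Q t z d _ z1 hd t1)) _.
  by move=> p /hQ[].
have -> : \sum_(1 <= n < (Num.truncn t).+1 | Q.-nat n) (t / n%:R) `^ (1 - d) =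
  t * t `^ (- d) * \sum_(1 <= n < (Num.truncn t).+1 | Q.-nat n) n%:R `^ (- (1 - d)).
  rewrite mulr_sumr; apply: eq_bigr => n _.
  rewrite powRM ?invr_ge0 //; last lra.
  rewrite powRD ?powRr1; [|lra|by rewrite gt_eqF ?implybT //; lra].
  by rewrite -powR_inv1 // -powRrM mulN1r.
set S := \sum_(_ <= _ < _ | _) _.
have S0 : 0 <= S by apply: sumr_ge0 => n _; exact: powR_ge0.
have zd0 : 0 <= z `^ d by exact: powR_ge0.
have td0 : 0 <= t `^ (- d) by exact: powR_ge0.
have h := @smooth_sum_powR_le R Q (Num.truncn t) z (1 - d) hQ z1 ltac:(lra).
have {}h : S * euler_prod Q z <= expR (8 * (z `^ d * (d * ln z))).
  apply: le_trans (ler_wpM2l S0 (euler_prod_rankin_le hQ z1 hd)) _.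
  by rewrite [leLHS]mulrA -[leRHS]mul1r; apply: ler_wpM2r; rewrite ?expR_ge0.
have : 0 <= 8 * t * t `^ (- d) * z `^ d by rewrite !mulr_ge0 //; lra.
move=> /ler_wpM2l /(_ _ _ h); set e := expR _; set E := euler_prod _ _.
by move=> h'; apply: le_trans (le_trans h' _); rewrite le_eqVlt; apply/orP; left; apply/eqP; ring.
Qed.

(* With v = u^(1/8) one has a + 8 a e^a <= 9 * 6 v^7, which is at most v^8 / 12 as
   soon as v >= 648. *)
Lemma exponent_le (R : realType) (a u : R) : 648 ^+ 8 <= u ->
  0 <= a <= 3 / 4 * ln u -> a + 8 * (expR a * a) <= u / 12.
Proof.
move=> hu /andP[a0 au].
have u1 : 1 <= u by apply: le_trans hu; rewrite exprn_ege1 //; lra.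
have u0 : 0 < u by lra.
set v := u `^ 8^-1.
have v0 : 0 < v by exact: powR_gt0.
have v8 : v ^+ 8 = u by rewrite -powR_mulrn ?(ltW v0) // -powRrM mulVf // powRr1 // ltW.
have v648 : 648 <= v.
  rewrite leNgt; apply/negP => v648.
  by move: hu; rewrite -v8 leNgt ltrXn2r // ltW.
have lv : ln u = 8 * ln v by rewrite /v ln_powR mulrA mulfV ?mul1r.
have lvv : ln v <= v by apply/ltW/ln_sublinear.
have ea : expR a <= v ^+ 6.
  apply: (@le_trans _ _ (expR (6 * ln v))); first by rewrite ler_expR; lra.
  by rewrite expRM_natl lnK ?posrE.
have e1 : 1 <= expR a by rewrite -expR0 ler_expR.
have h1 : a * expR a <= 6 * v * v ^+ 6.
  by apply: ler_pM => //; rewrite ?expR_ge0 //; lra.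
have -> : u = v * (v * v ^+ 6) by rewrite -!exprS.
have : 648 * (v * v ^+ 6) <= v * (v * v ^+ 6).
  by rewrite ler_wpM2r // mulr_ge0 ?exprn_ge0 // ltW.
by nra.
Qed.

(* Rankin's exponent 1 - d with x^(d/u) = u^(3/4), truncated at d = 1/2; the two
   error terms come from the two regimes. *)
Lemma psi_smooth_le (R : realType) (Q : nat_pred) (x u t : R) :
  648 ^+ 8 <= u -> u <= ln x -> 1 <= x -> x `^ (1 / 2) <= t ->
  (forall p, p \in Q -> prime p /\ p%:R <= x `^ u^-1) ->
  (1 + ln t) * (Psi t Q)%:R * euler_prod Q (x `^ u^-1) <=
  8 * t * (x `^ (- (1 / 6)) + u `^ (- (u / 4))).
Proof.
move=> hu ux x1 xt hQ.
have u3 : 3 <= u.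
  apply: le_trans hu; apply: (@le_trans _ _ (648 ^+ 1)); first by rewrite expr1; lra.
  by apply: ler_weXn2l => //; lra.
have x0 : 0 < x by lra.
have u0 : 0 < u by lra.
have lnu : 2 / 3 <= ln u.
  have := @le_ln1Dx R (u^-1 - 1); rewrite [1 + _]addrC subrK lnV ?posrE //.
  have : 0 < u^-1 by rewrite invr_gt0.
  have : u^-1 <= 3^-1 by rewrite lef_pV2 ?posrE.
  by move=> h1 h2 h3; have := h3 ltac:(lra); lra.
set z := x `^ u^-1.
have xe s : x `^ s = expR (s * ln x) by rewrite /powR gt_eqF.
have lz : ln z = ln x / u by rewrite ln_powR mulrC.
have lz1 : 1 <= ln z by rewrite lz ler_pdivlMr // mul1r.
have z1 : 1 <= z by rewrite /z -[leLHS](powRr0 x); apply: ler_powR; rewrite ?invr_ge0 ?(ltW u0).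
have t0 : 0 < t by apply: lt_le_trans xt; exact: powR_gt0.
have lt : ln x / 2 <= ln t.
  have : ln (x `^ (1 / 2)) <= ln t by rewrite ler_ln ?posrE ?powR_gt0.
  by rewrite ln_powR; lra.
have t1 : 1 <= t.
  rewrite leNgt; apply/negP => t1.
  by have := ln_lt0 (x := t); rewrite t0 t1 => /(_ isT); lra.
have lxu : ln x = u * ln z by rewrite lz; field; lra.
have key d : 0 <= d <= 2^-1 -> d * ln z <= 3 / 4 * ln u ->
    (1 + ln t) * (Psi t Q)%:R * euler_prod Q z <= 8 * t * expR (u / 12 - d * (ln x / 2)).
  move=> hd dz; have /andP[d0 d1] := hd; apply: le_trans (psi_rankin hQ z1 hd t1) _.
  rewrite ler_wpM2l //; first by rewrite mulr_ge0 // ltW.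
  have -> : z `^ d = expR (d * ln z) by rewrite /powR gt_eqF //; lra.
  have -> : t `^ (- d) = expR (- d * ln t) by rewrite /powR gt_eqF.
  rewrite -!expRD ler_expR.
  have a0 : 0 <= d * ln z by rewrite mulr_ge0 //; lra.
  have := @exponent_le R (d * ln z) u hu; rewrite a0 dz => /(_ isT).
  have : d * (ln x / 2) <= d * ln t by rewrite ler_wpM2l.
  by lra.
have tt : 0 <= 8 * t by lra.
have [h|h] := leP (3 / 4 * ln u) (ln z / 2).
  have dz : 3 / 4 * ln u / ln z * ln z = 3 / 4 * ln u by rewrite divfK //; lra.
  apply: le_trans (key (3 / 4 * ln u / ln z) _ _) _; last 1 first.
  - rewrite ler_wpM2l //; apply: (@le_trans _ _ (u `^ (- (u / 4)))).
      (* The exponent is u/12 - (3/8) u ln u; as ln u >= 2/3, u/12 is absorbed by (1/8) u ln u and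
         -(1/4) u ln u remains. *)
      rewrite [leRHS]/powR gt_eqF // ler_expR lxu.
      have -> : 3 / 4 * ln u / ln z * (u * ln z / 2) = 3 / 8 * (u * ln u).
        have -> : 3 / 4 * ln u / ln z * (u * ln z / 2) =
          (3 / 4 * ln u / ln z * ln z) * u / 2 by ring.
        by rewrite dz; lra.
      have : u * (2 / 3) <= u * ln u by rewrite ler_wpM2l // ltW.
      by lra.
    by rewrite lerDr powR_ge0.
  - rewrite divr_ge0 ?ler_pdivrMr /=; lra.
  - by rewrite dz.
apply: le_trans (key 2^-1 _ _) _; last 1 first.
- rewrite ler_wpM2l //; apply: (@le_trans _ _ (x `^ (- (1 / 6)))).
    (* At d = 1/2 the exponent is u/12 - (ln x)/4, at most -(ln x)/6 because u <= ln x. *)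
    by rewrite xe ler_expR; lra.
  by rewrite lerDl powR_ge0.
- by apply/andP; split; lra.
- by lra.
Qed.

(** * Splitting off the large primes *)

Lemma psi_hall (R : realType) (Q : nat_pred) (t z : R) :
  (forall p, p \in Q -> prime p /\ p%:R <= z) -> 1 <= z -> 1 <= t ->
  (1 + ln t) * (Psi t Q)%:R * euler_prod Q z <= 8 * t.
Proof.
move=> hQ z1 t1; have := @psi_rankin R Q t z 0 hQ z1 ltac:(lra) t1.
by rewrite oppr0 !powRr0 mul0r !mulr0 expR0 !mulr1.
Qed.

Lemma le_euler_prod (R : realType) (P Q : nat_pred) (t z : R) :
  (forall p, p \in P -> prime p) ->
  (forall p, p \in Q -> prime p /\ p \in P) -> 0 <= z <= t ->
  euler_prod P t <= euler_prod Q z.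
Proof.
move=> hP hQ /andP[z0 zt]; rewrite /euler_prod.
have Ntz : (Num.truncn z <= Num.truncn t)%N by exact: le_truncn.
rewrite [leRHS](big_nat_widen _ _ (Num.truncn t).+1) ?ltnS //.
rewrite [leLHS]big_mkcond [leRHS]big_mkcond /=; apply: ler_prod => p _.
have [pP|pP] := boolP (p \in P).
  have := inv_prime_itv R (hP _ pP).
  by case: ifP => _; lra.
by case: ifP => [/andP[/hQ[_]]|]; rewrite ?(negbTE pP) // ler01 lexx.
Qed.

Lemma euler_prod_excluded (R : realType) (P : nat_pred) (x t : R) :
  (forall p, p \in P -> prime p) -> 0 <= t <= x ->
  euler_prod [pred p | prime p] t = euler_prod (excluded x P) t * euler_prod P t.
Proof.
move=> hP /andP[t0 tx]; rewrite /euler_prod (bigID (mem P)) /= mulrC.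
congr (_ * _); apply: congr_big_nat => // p /andP[p1 pt]; rewrite !inE.
  have -> : p%:R <= x :> R by apply: le_trans tx; rewrite -truncn_ge_nat.
  by [].
by apply/andb_idl => /hP.
Qed.

Lemma psi_le_of_weighted (R : realType) (P : nat_pred) (x t B : R) (A : nat) :
  (forall p, p \in P -> prime p) -> 1 <= t <= x ->
  (1 + ln t) * A%:R * euler_prod P t <= B ->
  A%:R <= 4 * expR 2 * B * euler_prod (excluded x P) t.
Proof.
move=> hP /andP[t1 tx] h.
have m := mertens_euler_prod t1; rewrite (euler_prod_excluded (x := x) hP) in m; last lra.
have E0 : 0 <= euler_prod (excluded x P) t.
  by apply/ltW/euler_prod_gt0 => p /and3P[].
have A0 : 0 <= A%:R :> R by [].
have := ler_wpM2l A0 m; rewrite mulr1 => /le_trans; apply.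
have e0 := expR_ge0 (2 : R).
have : 0 <= 4 * expR 2 * euler_prod (excluded x P) t by rewrite !mulr_ge0.
move=> /ler_wpM2l /(_ _ _ h); lra.
Qed.

Definition small_primes (R : realType) (P : nat_pred) (z : R) : nat_pred :=
  [pred p | (p \in P) && (p%:R <= z)].

(** The range N of the primes is decoupled from t so that, at t < x, the sum over p still has the
    range of [kappa]. *)
Lemma psi_split (R : realType) (P : nat_pred) (t z : R) (N : nat) :
  1 <= t -> (Num.truncn t <= N)%N ->
  (Psi t P <= Psi t (small_primes P z) +
   \sum_(1 <= p < N.+1 | [&& p \in P, prime p & (z < p%:R)%R]) Psi (t / p%:R)%R P)%N.
Proof.
move=> t1; set T := Num.truncn t => TN; rewrite {1 2}/Psi -/T.
set Q := small_primes P z.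
apply: (@leq_trans (\sum_(1 <= n < T.+1 | P.-nat n) ((Q.-nat n : nat) +
   \sum_(1 <= p < N.+1 | [&& p \in P, prime p & (z < p%:R)%R]) (p %| n : nat)))).
  rewrite [X in (X <= _)%N]big_mkcond [X in (_ <= X)%N]big_mkcond /=.
  rewrite big_nat_cond [X in (_ <= X)%N]big_nat_cond.
  apply: leq_sum => n /andP[/andP[n1 nT] _]; case: ifP => // Pn.
  have [//|] := boolP (Q.-nat n).
  rewrite /pnat n1 /= => /allPn[p]; rewrite mem_primes => /and3P[pp _ pn].
  have pP := pnatP _ n1 Pn p pp pn.
  rewrite /Q /small_primes inE /= pP /= -ltNge => zp.
  have pn' := dvdn_leq n1 pn.
  rewrite add0n big_mkcond (bigD1_seq p) ?iota_uniq //=.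
    by rewrite pP pp zp pn.
  by rewrite mem_index_iota prime_gt0 //; lia.
rewrite big_split /= leq_add //.
  rewrite [X in (X <= _)%N]big_mkcond [X in (_ <= X)%N]big_mkcond /=.
  by apply: leq_sum => n _; case: ifP => //; case: (Q.-nat n).
rewrite exchange_big /=.
rewrite [X in (X <= _)%N]big_mkcond [X in (_ <= X)%N]big_mkcond /=.
apply: leq_sum => p _; case: ifP => // /and3P[pP pp zp].
have -> : (\sum_(1 <= n < T.+1 | P.-nat n) (p %| n) =
  \sum_(1 <= n < T.+1 | (p %| n) && P.-nat n) 1)%N.
  by rewrite big_mkcond [RHS]big_mkcond /=; apply: eq_bigr => n _;
    case: (_ %| _)%N; case: (P.-nat n).
rewrite (@sum_multiples _ P.-nat (fun=> 1%N)) ?prime_gt0 //.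
rewrite /Psi [X in (_ <= X)%N](big_cat_nat (n := (T %/ p).+1)) //=; last first.
  rewrite ltnS truncn_ge_nat; last by rewrite divr_ge0 //; lra.
  rewrite ler_pdivlMr ?ltr0n ?prime_gt0 // -natrM.
  apply: (@le_trans _ _ T%:R); first by rewrite ler_nat leq_trunc_div.
  by rewrite truncn_le; lra.
apply: leq_trans (leq_addr _ _).
rewrite [X in (X <= _)%N]big_mkcond [X in (_ <= X)%N]big_mkcond /=.
by apply: leq_sum => n _; rewrite pnatM; case: (P.-nat p); case: (P.-nat n).
Qed.

Lemma kappaE (R : realType) (x u : R) (P : nat_pred) :
  (forall p, p \in P -> prime p) ->
  kappa x P u = \sum_(1 <= p < (Num.truncn x).+1 | [&& p \in P, prime p & x `^ u^-1 < p%:R]) p%:R^-1.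
Proof.
move=> hP; apply: eq_bigl => p.
by have [/hP ->|//] := boolP (p \in P).
Qed.

Lemma kappa_ge0 (R : realType) (x u : R) (P : nat_pred) : 0 <= kappa x P u.
Proof. by apply: sumr_ge0 => p _; rewrite invr_ge0. Qed.

(** Telescoping with a half-integer shift, 1/n^2 <= 1/(n - 1/2) - 1/(n + 1/2), works uniformly down
    to k = 1. *)
Lemma sum_inv_sqr_le (R : realType) (k N : nat) : (0 < k)%N ->
  \sum_(k <= n < N) (n%:R : R)^-1 ^+ 2 <= 2 / k%:R.
Proof.
move=> k0; have k1 : 1 <= k%:R :> R by rewrite ler1n.
have [Nk|kN] := ltnP N k; first by rewrite big_geq 1?ltnW // divr_ge0.
suff : \sum_(k <= n < N) (n%:R : R)^-1 ^+ 2 <= (k%:R - 2^-1)^-1 - (N%:R - 2^-1)^-1.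
  have : (k%:R - 2^-1)^-1 <= 2 / k%:R :> R.
    rewrite ler_pdivlMr; last lra.
    by rewrite ler_pdivrMl; lra.
  have : 0 <= (N%:R - 2^-1)^-1 :> R.
    rewrite invr_ge0; have : k%:R <= N%:R :> R by rewrite ler_nat.
    by lra.
  lra.
elim: N kN => [|N IH]; first by rewrite leqn0 => /eqP k0'; rewrite k0' in k0.
rewrite leq_eqVlt => /orP[/eqP <-|]; first by rewrite big_geq // subrr.
rewrite ltnS => kN; rewrite big_nat_recr //=.
apply: le_trans (lerD (IH kN) (lexx _)) _.
have n1 : 1 <= N%:R :> R by rewrite ler1n; lia.
rewrite -[N.+1]addn1 natrD; set n : R := N%:R.
have : (n - 2^-1)^-1 - (n + 1 - 2^-1)^-1 = (n ^+ 2 - 4^-1)^-1.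
  by field; rewrite -/n in n1; apply/and3P; split; apply: lt0r_neq0; nra.
have : n^-1 ^+ 2 <= (n ^+ 2 - 4^-1)^-1.
  by rewrite exprVn lef_pV2 ?posrE; rewrite -/n in n1; nra.
by lra.
Qed.

Lemma sum_inv_ge (R : realType) (a b : nat) : (0 < a <= b)%N ->
  ln (b%:R : R) - ln a%:R <= \sum_(a <= n < b) n%:R^-1.
Proof.
move=> /andP[a0]; elim: b => [|b IH]; first by lia.
rewrite leq_eqVlt => /orP[/eqP <-|]; first by rewrite big_geq // subrr.
rewrite ltnS => ab; rewrite big_nat_recr //=.
have b0 : 0 < b%:R :> R by rewrite ltr0n; lia.
have : ln (b.+1%:R : R) <= ln b%:R + b%:R^-1.
  have -> : b.+1%:R = b%:R * (1 + b%:R^-1) :> R.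
    by rewrite -[b.+1]addn1 natrD; field; rewrite gt_eqF.
  have i0 : 0 < b%:R^-1 :> R by rewrite invr_gt0.
  rewrite lnM ?posrE ?addr_gt0 //.
  by rewrite lerD2l; apply: le_ln1Dx; lra.
by have := IH ab; lra.
Qed.

(** Exchange of summation: m is counted by Psi(n/p) exactly for n >= pm, and the tail of 1/n^2 from
    pm on is at most 2/(pm). *)
Lemma sum_psi_div_sqr_le (R : realType) (P : nat_pred) (p a N : nat) :
  (0 < p)%N -> (0 < a)%N ->
  \sum_(a <= n < N.+1) (Psi ((n%:R : R) / p%:R) P)%:R * (n%:R : R)^-1 ^+ 2 <=
  2 * p%:R^-1 * \sum_(1 <= m < N.+1 | P.-nat m) (m%:R : R)^-1.
Proof.
move=> p0 a0.
have p0' : 0 < p%:R :> R by rewrite ltr0n.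
apply: (@le_trans _ _ (\sum_(1 <= n < N.+1) \sum_(1 <= m < N.+1 | P.-nat m)
    if (p * m <= n)%N then (n%:R : R)^-1 ^+ 2 else 0)).
  apply: (@le_trans _ _ (\sum_(1 <= n < N.+1) (Psi ((n%:R : R) / p%:R) P)%:R * (n%:R : R)^-1 ^+ 2)).
    rewrite [leLHS](big_nat_widenl _ 1) //=.
    apply: (@le_sum_nat_sub _ _ _ _ predT) => [n /andP[_ ->] //|n _].
    by rewrite mulr_ge0 ?exprn_ge0 ?invr_ge0.
  apply: ler_sum_nat => n /andP[n1 nN].
  rewrite /Psi natr_sum mulr_suml -big_mkcondr /=.
  under eq_bigr do rewrite mul1r.
  apply: le_sum_nat_sub => [m /andP[m1 mn] Pm|m _]; last by rewrite exprn_ge0 ?invr_ge0.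
  have pmn : (p * m <= n)%N.
    move: mn; rewrite ltnS truncn_ge_nat ?divr_ge0 //.
    by rewrite ler_pdivlMr // -natrM ler_nat mulnC.
  rewrite Pm pmn /=; apply: leq_trans nN.
  by rewrite ltnS; apply: leq_trans pmn; rewrite leq_pmull.
rewrite exchange_big /= mulr_sumr.
rewrite [leLHS]big_mkcond [leRHS]big_mkcond /=; apply: ler_sum_nat => m /andP[m1 _].
case: ifP => // _; rewrite -big_mkcond /= -mulrA -invfM -natrM.
apply: le_trans (@sum_inv_sqr_le R (p * m) N.+1 _); last by rewrite muln_gt0 p0.
rewrite [leRHS](big_nat_widenl _ 1) /=; last by rewrite muln_gt0 p0.
by [].
Qed.

(* Averaging Psi(n/p; P) / n against dn/n over [sqrt x, x] makes the contribution
   of a large prime p proportional to 1/p. *)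
Lemma exists_good_point (R : realType) (P : nat_pred) (x z : R) :
  (forall p, p \in P -> prime p /\ p%:R <= x) -> 5 <= ln x -> 1 <= x ->
  let N := Num.truncn x in
  exists n : nat, x `^ (1 / 2) <= n%:R <= x /\
   (1 + ln x) * euler_prod P x *
     (\sum_(1 <= p < N.+1 | [&& p \in P, prime p & z < p%:R]) Psi ((n%:R : R) / p%:R) P)%:R <=
   8 * (\sum_(1 <= p < N.+1 | [&& p \in P, prime p & z < p%:R]) (p%:R : R)^-1) * n%:R.
Proof.
move=> hP x5 x1 N.
set k := \sum_(1 <= p < N.+1 | _) _^-1.
pose B n := (\sum_(1 <= p < N.+1 | [&& p \in P, prime p & z < p%:R]) Psi ((n%:R : R) / p%:R) P)%:R : R.
have k0 : 0 <= k by apply: sumr_ge0 => p _; rewrite invr_ge0.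
set s := x `^ (1 / 2).
have s0 : 0 < s by apply: powR_gt0; lra.
have ls : ln s = ln x / 2 by rewrite ln_powR; lra.
have s1 : 1 <= s.
  rewrite leNgt; apply/negP => s1.
  by have := ln_lt0 (x := s); rewrite s0 s1 => /(_ isT); lra.
set a := (Num.truncn s).+1.
have sa : s <= a%:R by exact/ltW/truncnS_gt.
have a2 : a%:R <= 2 * s.
  have : (Num.truncn s)%:R <= s by rewrite truncn_le ltW.
  by rewrite /a -addn1 natrD; lra.
have la : ln (a%:R : R) <= 1 + ln x / 2.
  apply: (@le_trans _ _ (ln (2 * s))); first by rewrite ler_ln ?posrE //; lra.
  by rewrite lnM ?posrE // ls lerD2r ln2_le1.
have lN : ln x <= ln (N.+1%:R : R).
  by rewrite ler_ln ?posrE ?ltr0n //; [exact/ltW/truncnS_gt|lra].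
have aN : (a < N.+1)%N.
  rewrite ltnNge; apply/negP => Na.
  have : ln (N.+1%:R : R) <= ln (a%:R : R) by rewrite ler_ln ?posrE ?ltr0n // ler_nat.
  lra.
(* The sum is at least ln x - (1 + (ln x)/2), and 5 <= ln x is exactly what makes this at least (1 +
   ln x)/4. *)
have hsum : (1 + ln x) / 4 <= \sum_(a <= n < N.+1) (n%:R : R)^-1.
  have := @sum_inv_ge R a N.+1 (ltnW aN).
  lra.
have E0 : 0 < euler_prod P x by apply: euler_prod_gt0 => p /hP[].
have hB : \sum_(a <= n < N.+1) B n * (n%:R : R)^-1 ^+ 2 <=
    2 * k * \sum_(1 <= m < N.+1 | P.-nat m) (m%:R : R)^-1.
  rewrite /B; under eq_bigr do rewrite natr_sum mulr_suml.
  rewrite exchange_big /= [_ * k]mulr_sumr mulr_suml; apply: ler_sum => p /and3P[_ pp _].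
  exact: sum_psi_div_sqr_le (prime_gt0 pp) (ltn0Sn _).
have hE : (\sum_(1 <= m < N.+1 | P.-nat m) (m%:R : R)^-1) * euler_prod P x <= 1.
  apply: le_trans (@smooth_sum_powR_le R P N x 1 hP x1 ler01).
  rewrite euler_prodE; last by move=> p /hP[].
  rewrite le_eqVlt; apply/orP; left; apply/eqP.
  by congr (_ * _); apply: eq_bigr => n _; rewrite powR_inv1.
have [[n [an nN h]]|hn] := pselect (exists n, [/\ (a <= n)%N, (n < N.+1)%N &
    (1 + ln x) * euler_prod P x * B n <= 8 * k * n%:R]).
  exists n; split=> //; apply/andP; split.
    by apply: le_trans sa _; rewrite ler_nat.
  by move: nN; rewrite ltnS truncn_ge_nat //; lra.
exfalso.
(* If every n fails, summing the failures with weight 1/n^2 contradicts [hB], [hE] and [hsum]; the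
   constant 8 is the 2 of [hB] times the 4 of [hsum]. *)
have : \sum_(a <= n < N.+1) 8 * k * (n%:R : R)^-1 <
       \sum_(a <= n < N.+1) (1 + ln x) * euler_prod P x * (B n * (n%:R : R)^-1 ^+ 2).
  apply: ltr_sum_nat => // n /andP[an nN].
  have n0 : 0 < n%:R :> R by rewrite ltr0n; exact: leq_trans an.
  rewrite mulrA expr2 mulrA ltr_pM2r ?invr_gt0 // ltr_pdivlMr //.
  by rewrite ltNge; apply/negP => h; apply: hn; exists n.
rewrite -!mulr_sumr; apply/negP; rewrite -leNgt.
have l0 : 0 <= (1 + ln x) * euler_prod P x by rewrite mulr_ge0 ?(ltW E0) //; lra.
apply: le_trans (ler_wpM2l l0 hB) _.
have h1 : 0 <= (1 + ln x) * (2 * k) by rewrite !mulr_ge0 //; lra.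
have := ler_wpM2l h1 hE.
have h2 : 0 <= 8 * k by rewrite mulr_ge0.
have := ler_wpM2l h2 hsum.
by lra.
Qed.

(** * Assembling the two bounds *)

Lemma psi_large_eps_le (R : realType) (P : nat_pred) (x z eps : R) :
  (forall p, p \in P -> prime p /\ p%:R <= x) -> 1 < x -> 0 < eps ->
  (forall p : nat, p \in P -> 1 <= (p%:R : R) <= x `^ (1 - eps)) ->
  (1 + ln x) * euler_prod P x *
    (\sum_(1 <= p < (Num.truncn x).+1 | [&& p \in P, prime p & z < p%:R]) Psi (x / p%:R) P)%:R <=
  8 * x * ((\sum_(1 <= p < (Num.truncn x).+1 | [&& p \in P, prime p & z < p%:R]) (p%:R : R)^-1) / eps).
Proof.
move=> hP x1 e0 hPe; have lx : 0 < ln x by exact: ln_gt0.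
have E0 : 0 < euler_prod P x by apply: euler_prod_gt0 => p /hP[].
rewrite natr_sum mulr_suml !mulr_sumr; apply: ler_sum => p /and3P[pP pp _].
have /andP[p1 pe] := hPe p pP.
have p0 : 0 < p%:R :> R by lra.
have lpe : ln (p%:R : R) <= (1 - eps) * ln x.
  by rewrite -ln_powR ler_ln ?posrE // powR_gt0; lra.
have lp0 : 0 <= ln (p%:R : R) by rewrite ln_ge0.
(* As p >= 1 and p <= x^(1 - eps) with x > 1, eps cannot exceed 1; hence 1 + ln(x/p) >= 1 + eps ln x
   >= eps (1 + ln x). *)
have e1 : eps <= 1.
  rewrite leNgt; apply/negP => e1.
  have : (eps - 1) * ln x > 0 by rewrite mulr_gt0 // subr_gt0.
  by lra.
have y1 : 1 <= x / p%:R by rewrite ler_pdivlMr // mul1r (hP p pP).2.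
have ly : eps * (1 + ln x) <= 1 + ln (x / p%:R).
  by rewrite ln_div ?posrE //; lra.
have := @psi_hall R P (x / p%:R) x hP (ltW x1) y1.
set A := (Psi _ _)%:R => h.
have A0 : 0 <= A :> R by [].
have : eps * (1 + ln x) * (A * euler_prod P x) <= (1 + ln (x / p%:R)) * (A * euler_prod P x).
  by rewrite ler_wpM2r // mulr_ge0 // ltW.
move=> h'.
have -> : 8 * x * (p%:R^-1 / eps) = 8 * (x / p%:R) / eps by ring.
rewrite ler_pdivlMr //; lra.
Qed.

(** The primes of P in (t, x] all exceed x^(1/u), so [kappa] counts them, and each satisfies (1 +
    2/p)(1 - 1/p) >= 1 because p >= 2. *)
Lemma euler_prod_kappa_le (R : realType) (P : nat_pred) (x u t : R) :
  (forall p, p \in P -> prime p) -> 0 <= t <= x -> x `^ u^-1 <= t ->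
  euler_prod P t <= expR (2 * kappa x P u) * euler_prod P x.
Proof.
move=> hP /andP[t0 tx] zt.
rewrite /kappa mulr_sumr expR_sum /euler_prod.
have Ntx : (Num.truncn t <= Num.truncn x)%N by exact: le_truncn.
rewrite (big_nat_widen _ _ (Num.truncn x).+1) ?ltnS //.
rewrite [X in X <= _]big_mkcond [X in X * _]big_mkcond [X in _ * X]big_mkcond -big_split /=.
rewrite big_nat_cond [leRHS]big_nat_cond.
apply: ler_prod => p /andP[/andP[p1 _] _].
have [pP|pP] /= := boolP (p \in P); last by rewrite mulr1 ler01 lexx.
have hp := inv_prime_itv R (hP _ pP).
have e1 := expR_ge1Dx (2 * (p%:R : R)^-1).
rewrite ltnS truncn_ge_nat //.
have [pt|pt] := leP p%:R t; have [zp|zp] := ltP (x `^ u^-1) p%:R; rewrite ?mul1r.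
- by apply/andP; split; nra.
- by apply/andP; split; lra.
- by apply/andP; split; [lra|nra].
- by have := le_lt_trans (le_trans zp zt) pt; rewrite ltxx.
Qed.

Lemma powR_neg_small_ge (R : realType) (u U : R) : 1 <= u <= U ->
  1 <= U `^ (U / 4) * u `^ (- (u / 4)).
Proof.
move=> /andP[u1 uU]; have u0 : 0 < u by lra.
rewrite powRN ler_pdivlMr ?powR_gt0 // mul1r; apply: (@le_trans _ _ (u `^ (U / 4))).
  by apply: ler_powR; lra.
by apply: ge0_ler_powR; rewrite ?nnegrE; lra.
Qed.

Lemma powRV_le_sqrt (R : realType) (x u : R) : 1 <= x -> 2 <= u ->
  x `^ u^-1 <= x `^ (1 / 2).
Proof.
by move=> x1 u2; apply: ler_powR => //; rewrite mul1r lef_pV2 ?posrE; lra.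
Qed.

Lemma psi_small_primes_le (R : realType) (P : nat_pred) (x u t : R) :
  (forall p, p \in P -> prime p /\ p%:R <= x) -> 3 <= x -> 1 <= u <= ln x ->
  648 ^+ 8 <= u -> x `^ (1 / 2) <= t <= x ->
  (1 + ln t) * euler_prod P t * (Psi t (small_primes P (x `^ u^-1)))%:R <=
  8 * t * (x `^ (- (1 / 6)) + u `^ (- (u / 4))).
Proof.
move=> hP x3 /andP[u1 ux] hu /andP[xt tx]; set Q := small_primes P _.
have hQ p : p \in Q -> prime p /\ p%:R <= x `^ u^-1 by move=> /andP[/hP[pp _] pz].
apply: le_trans (psi_smooth_le hu ux _ xt hQ); last lra.
have u2 : 2 <= u.
  apply: le_trans hu; apply: (@le_trans _ _ (648 ^+ 1)); first by rewrite expr1; lra.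
  by apply: ler_weXn2l => //; lra.
have t1 : 1 <= t.
  by apply: le_trans xt; rewrite -[leLHS](powRr0 x) ler_powR //; lra.
rewrite mulrAC ler_wpM2l //; first by rewrite mulr_ge0 // addr_ge0 // ln_ge0.
(* The weight over P up to t contains every factor of the product over the small primes, as x^(1/u)
   <= sqrt x <= t, so it is the smaller one. *)
apply: le_euler_prod => [p /hP[]//|p /andP[pP _]|].
  by split=> //; have [] := hP p pP.
by rewrite powR_ge0 (le_trans (powRV_le_sqrt _ u2)) //; lra.
Qed.

Lemma psi_split_weighted (R : realType) (P : nat_pred) (x t z : R) :
  (forall p, p \in P -> prime p) -> 1 <= t <= x ->
  (1 + ln t) * (Psi t P)%:R * euler_prod P t <=
  (1 + ln t) * euler_prod P t * (Psi t (small_primes P z))%:R +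
  (1 + ln t) * euler_prod P t *
   (\sum_(1 <= p < (Num.truncn x).+1 | [&& p \in P, prime p & z < p%:R])
      Psi (t / p%:R) P)%:R.
Proof.
move=> hP /andP[t1 tx]; have := @psi_split R P t z (Num.truncn x) t1 (le_truncn tx).
rewrite -(ler_nat R) natrD => h; rewrite mulrAC -mulrDr ler_wpM2l //.
by rewrite mulr_ge0 ?addr_ge0 ?ln_ge0 //; apply/ltW/euler_prod_gt0.
Qed.

(** Here k stands for kappa in (a) and for kappa / eps in (b); only k >= 0 matters, since the error
    term alone already exceeds a constant. *)
Lemma weighted_bound_small_u (R : realType) (P : nat_pred) (x u k c : R) :
  (forall p, p \in P -> prime p /\ p%:R <= x) -> 3 <= x -> 1 <= u <= ln x ->
  u <= 648 ^+ 8 -> 1 <= c -> 0 <= k ->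
  (1 + ln x) * (Psi x P)%:R * euler_prod P x <=
  8 * (c + (648 ^+ 8) `^ (648 ^+ 8 / 4)) * x *
    (k + (x `^ (- (1 / 6)) + u `^ (- (u / 4)))).
Proof.
move=> hP x3 /andP[u1 ux] uU c1 k0; apply: le_trans (psi_hall hP _ _) _; [lra|lra|].
have := @powR_neg_small_ge R u (648 ^+ 8); rewrite u1 uU => /(_ isT) => h.
set err := _ + u `^ _.
have h' : 1 <= (c + (648 ^+ 8) `^ (648 ^+ 8 / 4)) * (k + err).
  apply: le_trans h _; apply: ler_pM; rewrite ?powR_ge0 //; first lra.
  by have := powR_ge0 x (- (1 / 6)); rewrite /err; lra.
have x0 : 0 <= 8 * x by lra.
by have := ler_wpM2l x0 h'; lra.
Qed.

Lemma weighted_bound_a (R : realType) (P : nat_pred) (x u K : R) :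
  (forall p, p \in P -> prime p /\ p%:R <= x) -> 3 <= x -> 1 <= u <= ln x ->
  kappa x P u <= K ->
  exists2 t : R, x `^ (1 / 2) <= t <= x &
    (1 + ln t) * (Psi t P)%:R * euler_prod P t <=
    8 * (expR (2 * K) + (648 ^+ 8) `^ (648 ^+ 8 / 4)) * t *
      (kappa x P u + (x `^ (- (1 / 6)) + u `^ (- (u / 4)))).
Proof.
move=> hP x3 uxh kK; have /andP[u1 ux] := uxh; set err := _ + u `^ _.
have k0 := kappa_ge0 x u P.
have K0 : 0 <= K by exact: le_trans kK.
have eK : 1 <= expR (2 * K) by rewrite -[leLHS]expR0 ler_expR; lra.
have [uU|hu] := leP u (648 ^+ 8).
  exists x; last exact: weighted_bound_small_u.
  rewrite lexx andbT -[leRHS]powRr1; last lra.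
  by apply: ler_powR; lra.
have u5 : 5 <= u.
  apply: le_trans (ltW hu); apply: (@le_trans _ _ (648 ^+ 1)); first by rewrite expr1; lra.
  by apply: ler_weXn2l => //; lra.
have [n [/andP[xn nx] hn]] := @exists_good_point R P x (x `^ u^-1) hP ltac:(lra) ltac:(lra).
set t : R := n%:R in xn nx hn *.
exists t; first by rewrite xn.
have t1 : 1 <= t.
  by apply: le_trans xn; rewrite -[leLHS](powRr0 x) ler_powR //; lra.
apply: le_trans (@psi_split_weighted R P x t (x `^ u^-1) _ _) _; [by move=> p /hP[]|by rewrite t1|].
apply: le_trans (lerD (psi_small_primes_le hP x3 uxh (ltW hu) _) (lexx _)) _; first by rewrite xn.
rewrite -kappaE in hn; last by move=> p /hP[].
have zt : x `^ u^-1 <= t by apply: le_trans xn; apply: powRV_le_sqrt; lra.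
(* The good point n was controlled with the Euler product up to x, whereas the weight to be bounded
   is the one up to t. *)
have hE : euler_prod P t <= expR (2 * K) * euler_prod P x.
  apply: (@le_trans _ _ (expR (2 * kappa x P u) * euler_prod P x)).
    by apply: euler_prod_kappa_le => // [p /hP[]//|]; apply/andP; split; lra.
  rewrite ler_wpM2r ?ler_expR //; last lra.
  by apply/ltW/euler_prod_gt0 => p /hP[].
move: hn; set B := (\sum_(_ <= _ < _ | _) _)%N => hn.
have hB : (1 + ln t) * euler_prod P t * B%:R <= expR (2 * K) * (8 * kappa x P u * t).
  apply: le_trans (ler_wpM2l (expR_ge0 _) hn).
  rewrite mulrA ler_wpM2r // mulrCA; apply: ler_pM => //.
  - by rewrite addr_ge0 ?ln_ge0.
  - by apply/ltW/euler_prod_gt0 => p /hP[].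
  - by rewrite lerD2l ler_ln ?posrE //; lra.
apply: le_trans (lerD (lexx _) hB) _.
have e0 : 0 <= err by rewrite addr_ge0 ?powR_ge0.
set G := (648 ^+ 8) `^ (648 ^+ 8 / 4).
have G0 : 0 <= G by exact: powR_ge0.
have te : 0 <= t * err by rewrite mulr_ge0 //; lra.
have tk : 0 <= t * kappa x P u by rewrite mulr_ge0 //; lra.
have h1 := ler_wpM2r te eK; have h2 := mulr_ge0 G0 te; have h3 := mulr_ge0 G0 tk.
by rewrite -/err; lra.
Qed.

Lemma weighted_bound_b (R : realType) (P : nat_pred) (x u eps c : R) :
  (forall p, p \in P -> prime p /\ p%:R <= x) -> 3 <= x -> 1 <= u <= ln x ->
  1 <= c -> 0 < eps ->
  (forall p : nat, p \in P -> 1 <= (p%:R : R) <= x `^ (1 - eps)) ->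
  (1 + ln x) * (Psi x P)%:R * euler_prod P x <=
  8 * (c + (648 ^+ 8) `^ (648 ^+ 8 / 4)) * x *
    (kappa x P u / eps + (x `^ (- (1 / 6)) + u `^ (- (u / 4)))).
Proof.
move=> hP x3 uxh c1 e0 he; have /andP[u1 ux] := uxh; set err := _ + u `^ _.
have k0 : 0 <= kappa x P u / eps by rewrite divr_ge0 ?kappa_ge0 // ltW.
have [uU|hu] := leP u (648 ^+ 8); first exact: weighted_bound_small_u.
apply: le_trans (@psi_split_weighted R P x x (x `^ u^-1) _ _) _.
- by move=> p /hP[].
- by apply/andP; split; lra.
have := @psi_large_eps_le R P x (x `^ u^-1) eps hP ltac:(lra) e0 he.
rewrite -kappaE; last by move=> p /hP[].
move=> h; apply: le_trans (lerD (psi_small_primes_le hP x3 uxh (ltW hu) _) h) _.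
  rewrite lexx andbT -[leRHS]powRr1; last lra.
  by apply: ler_powR; lra.
set G := (648 ^+ 8) `^ (648 ^+ 8 / 4).
have G0 : 0 <= G by exact: powR_ge0.
have e1 : 0 <= err by rewrite addr_ge0 ?powR_ge0.
have h1 : 0 <= 8 * x * (kappa x P u / eps + err) by apply: mulr_ge0; [lra|exact: addr_ge0].
have cG : 1 <= c + G by lra.
by have := ler_wpM2l h1 cG; rewrite -/err; lra.
Qed.

(** * Little-o consequences *)

Lemma littleo_of_le (R : realType) (I : Type) (F : filter_on I) (f g b : I -> R) :
  (forall i, 0 <= f i) -> (forall i, 0 <= g i) -> (forall i, f i <= b i * g i) ->
  (forall e : R, 0 < e -> \forall i \near F, b i <= e) ->
  (f : I -> R^o) =o_F (g : I -> R^o).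
Proof.
move=> f0 g0 fbg hb; apply/eqoP => e e0.
apply: filterS (hb e e0) => i bi.
rewrite /= !ger0_norm //; apply: le_trans (fbg i) _.
exact: ler_wpM2r.
Qed.

Lemma near_error_le (R : realType) (I : Type) (F : filter_on I) (x u k : I -> R) (C : R) :
  0 < C -> (forall i, 0 <= k i) ->
  u i @[i --> F] --> +oo -> x i @[i --> F] --> +oo ->
  (fun i => k i : R^o) =o_F (fun=> 1 : R^o) ->
  forall e : R, 0 < e ->
  \forall i \near F, C * (k i + x i `^ (- (1 / 6)) + u i `^ (- (u i / 4))) <= e.
Proof.
move=> C0 k0 /cvgryPge hu /cvgryPge hx /eqoP hk e e0.
have d0 : 0 < e / (3 * C) by rewrite divr_gt0 // mulr_gt0.
set d := e / (3 * C) in d0.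
(* Each of the three terms gets d = e/(3C): x >= d^(-6) gives x^(-1/6) <= d, while u >= 4 and u >=
   1/d give u^(-u/4) <= 1/u <= d. *)
have := hk d d0; have := hx (d `^ (- 6)); have := hu (Num.max 4 d^-1).
move=> hu' hx' hk'; near=> i.
have hk1 : `|k i| <= d * `|1 : R| by near: i.
have hx1 : d `^ (- 6) <= x i by near: i.
have hu1 : Num.max 4 d^-1 <= u i by near: i.
have -> : e = C * (d + d + d).
  by rewrite /d; field; rewrite gt_eqF.
rewrite ler_pM2l //; apply: lerD; first apply: lerD.
- by move: hk1; rewrite normr1 mulr1 ger0_norm.
- have dx : 0 < d `^ (- 6) by exact: powR_gt0.
  have x0 : 0 < x i by apply: lt_le_trans hx1.
  rewrite powRN -[leRHS]invrK lef_pV2 ?posrE ?powR_gt0 ?invr_gt0 //.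
  have := @ge0_ler_powR R (1 / 6) _ _ _ _ _ hx1; rewrite !nnegrE => /(_ _ (ltW dx) (ltW x0)).
  rewrite -powRrM (_ : - 6 * (1 / 6) = -1); last by lra.
  by rewrite powR_inv1 ?(ltW d0) //; apply; lra.
- move: hu1; rewrite ge_max => /andP[u4 ud].
  have u0 : 0 < u i by lra.
  apply: (@le_trans _ _ (u i `^ (-1))); first by apply: ler_powR; lra.
  by rewrite powR_inv1 ?(ltW u0) // -[leRHS]invrK lef_pV2 ?posrE ?invr_gt0.
Unshelve. all: by end_near.
Qed.

Theorem proposition2p6 (R : realType) (K : R) (K_gt0 : 0 < K) :
  exists C : R,
  [/\ 0 < C,
      (* (a) *)
      forall (x : R) (P : nat_pred) (u : R), admissible K x P u ->
        exists t : R, x `^ (1 / 2) <= t <= x /\ sieve_bound_at C x P u t,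
      (* (b) *)
      forall (x : R) (P : nat_pred) (u : R), admissible K x P u ->
        forall eps : R, 0 < eps ->
        (forall p : nat, p \in P -> 1 <= (p%:R : R) <= x `^ (1 - eps)) ->
        (Psi x P)%:R / x <=
          C * (kappa x P u / eps + x `^ (- (1 / 6)) + u `^ (- (u / 4)))
            * euler_prod (excluded x P) x,
      (* little-o consequence of (a), for the points t provided there *)
      forall (I : Type) (F : filter_on I)
        (x : I -> R) (P : I -> nat_pred) (u t : I -> R),
        (forall i, admissible K (x i) (P i) (u i)) ->
        (forall i, x i `^ (1 / 2) <= t i <= x i) ->
        (forall i, sieve_bound_at C (x i) (P i) (u i) (t i)) ->
        u i @[i --> F] --> +oo -> x i @[i --> F] --> +oo ->
        (fun i => kappa (x i) (P i) (u i) : R^o) =o_F (fun=> 1 : R^o) ->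
        (fun i => (Psi (t i) (P i))%:R / t i : R^o) =o_F
          (fun i => euler_prod (excluded (x i) (P i)) (t i) : R^o)
    & (* little-o consequence of (b), where t = x and eps is fixed *)
      forall (eps : R) (I : Type) (F : filter_on I)
        (x : I -> R) (P : I -> nat_pred) (u : I -> R),
        0 < eps ->
        (forall i, admissible K (x i) (P i) (u i)) ->
        (forall i (p : nat), p \in P i -> 1 <= (p%:R : R) <= x i `^ (1 - eps)) ->
        u i @[i --> F] --> +oo -> x i @[i --> F] --> +oo ->
        (fun i => kappa (x i) (P i) (u i) : R^o) =o_F (fun=> 1 : R^o) ->
        (fun i => (Psi (x i) (P i))%:R / x i : R^o) =o_F
          (fun i => euler_prod (excluded (x i) (P i)) (x i) : R^o)].
Proof.
set G : R := (648 ^+ 8) `^ (648 ^+ 8 / 4).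
have G0 : 0 <= G by exact: powR_ge0.
have eK : 1 <= expR (2 * K) by rewrite -[leLHS]expR0 ler_expR; lra.
(* The factor 4 e^2 is Mertens' constant; the rest comes from the weighted bounds, with G covering
   the range of small u. *)
pose C := 4 * expR 2 * (8 * (expR (2 * K) + G)).
have C0 : 0 < C by rewrite /C !mulr_gt0 ?expR_gt0 //; lra.
have unweight (x t s : R) (P : nat_pred) :
    (forall p, p \in P -> prime p /\ p%:R <= x) -> 1 <= t <= x ->
    (1 + ln t) * (Psi t P)%:R * euler_prod P t <= 8 * (expR (2 * K) + G) * t * s ->
    (Psi t P)%:R / t <= C * s * euler_prod (excluded x P) t.
  move=> hP tx h; have t0 : 0 < t by lra.
  rewrite ler_pdivrMr //.
  apply: le_trans (psi_le_of_weighted _ tx h) _; first by move=> p /hP[].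
  by rewrite /C; lra.
have bound_b (x : R) (P : nat_pred) (u : R) : admissible K x P u ->
    forall eps : R, 0 < eps ->
    (forall p : nat, p \in P -> 1 <= (p%:R : R) <= x `^ (1 - eps)) ->
    (Psi x P)%:R / x <=
      C * (kappa x P u / eps + x `^ (- (1 / 6)) + u `^ (- (u / 4)))
        * euler_prod (excluded x P) x.
  move=> [x3 hP ux _] eps e0 he.
  rewrite -[_ / eps + _ + _]addrA; apply: unweight => //.
    by apply/andP; split; lra.
  exact: weighted_bound_b.
exists C; split=> //.
- move=> x P u [x3 hP ux kK].
  have [t xt ht] := weighted_bound_a hP x3 ux kK.
  exists t; split=> //; rewrite /sieve_bound_at -[kappa _ _ _ + _ + _]addrA.
  apply: unweight => //; move: xt => /andP[xt ->]; rewrite andbT.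
  by apply: le_trans xt; rewrite -[leLHS](powRr0 x) ler_powR //; lra.
- move=> I F x P u t adm xt bound hu hx hk.
  apply: (littleo_of_le _ _ bound) => [i|i|].
  + have /andP[xti _] := xt i.
    by rewrite divr_ge0 //; apply: le_trans xti; exact: powR_ge0.
  + by apply/ltW/euler_prod_gt0 => p /and3P[].
  + by apply: near_error_le => // i; exact: kappa_ge0.
- move=> eps I F x P u e0 adm he hu hx hk.
  apply: (littleo_of_le _ _ (fun i => bound_b _ _ _ (adm i) eps e0 (he i))) => [i|i|].
  + by have [x3 _ _ _] := adm i; rewrite divr_ge0 //; lra.
  + by apply/ltW/euler_prod_gt0 => p /and3P[].
  + apply: near_error_le => // [i|]; first by rewrite divr_ge0 ?kappa_ge0 // ltW.
    (* With eps fixed, kappa / eps is still o(1): kappa is taken below e * eps. *)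
    move/eqoP: hk => hk; apply/eqoP => e e1.
    apply: filterS (hk (e * eps) (mulr_gt0 e1 e0)) => i /=.
    by rewrite normr1 !mulr1 normrM normfV (gtr0_norm e0) ler_pdivrMr.
Qed.
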